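(* Consider the finite-sum bilevel problem, with $f=\frac1n\sum_{i=1}^nF_i$ and $g=\frac1m\sum_{j=1}^mG_j$. Fix a number of iterations $K>1$ and assume: (i) $\nabla f$ is $L^f$-Lipschitz in $(x,y)$, and there is $C^f>0$ with $\|\nabla_2 f(x,y^*(x))\|\le C^f$ for all $x$; (ii) $\nabla g$ and $\nabla^2 g$ are $L_1^g$- and $L_2^g$-Lipschitz in $(x,y)$, respectively, and $g(x,\cdot)$ is $\mu$-strongly convex for every $x$; (iii) the stochastic (here: component) maps $\nabla F_i$, $\nabla G_j$, $\nabla^2G_j$ are respectively $L^f$-, $L_1^g$-, $L_2^g$-Lipschitz in $(x,y)$. Then there exist positive constants $c_1,c_2,c_3,c_4$ such that if $$\alpha_k=c_1(n+m)^{-2/3},\quad \beta_k=c_2(n+m)^{-2/3},\quad \gamma_k=c_3(n+m)^{-2/3},\quad \rho_k=c_4(n+m)^{-2/3},$$ then the iterates of MA-SABA satisfy $$\frac1K\sum_{k=0}^{K-1}\mathbb{E}\left[\|\nabla H(x_k)\|^2\right]=\mathcal{O}\left((n+m)^{2/3}K^{-1}\right).$$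
   Context: Bilevel problem: minimize $H(x)=f(x,y^*(x))$ over $x\in\mathbb{R}^{d_x}$, where $y^*(x)=\arg\min_{y\in\mathbb{R}^{d_y}}g(x,y)$ and $f,g$ are smooth real-valued functions on $\mathbb{R}^{d_x}\times\mathbb{R}^{d_y}$. $\nabla_1,\nabla_2$ are the partial gradients in $x$ and $y$; $\nabla_{12}^2$ ($d_x\times d_y$) and $\nabla_{22}^2$ ($d_y\times d_y$) are blocks of the Hessian. MA-SABA. The inputs are initial points $(x_{-1},y_{-1},z_{-1})$, $(x_0,y_0,z_0)$ with $z$-components in $\mathbb R^{d_y}$, an initial direction $v_{-1}^x$, the number of iterations $K$, step sizes $\alpha_k,\beta_k,\gamma_k$ and momentum parameters $\rho_k$. The algorithm keeps memories $w_{k,i}=(w_{k,i}^x,w_{k,i}^y,w_{k,i}^z)$ for $i\in[n]$ (attached to $f$) and separate memories $w_{k,j}=(w_{k,j}^x,w_{k,j}^y,w_{k,j}^z)$ for $j\in[m]$ (attached to $g$). At each iteration $k$, two random independent indices $i_k\in[n]$, $j_k\in[m]$ are drawn uniformly. For a family $\phi_i(x,y)$ attached to $f$ let $$\mathcal M_f(\phi,k)=\phi_{i_k}(x_k,y_k)-\phi_{i_k}(w^x_{k,i_k},w^y_{k,i_k})+\tfrac1n\sum_{i=1}^n\phi_i(w^x_{k,i},w^y_{k,i}),$$ and for a family $\phi_j(x,y,z)$ attached to $g$ let $$\mathcal M_g(\phi,k)=\phi_{j_k}(x_k,y_k,z_k)-\phi_{j_k}(w_{k,j_k})+\tfrac1m\sum_{j=1}^m\phi_j(w_{k,j}).$$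 Here $\nabla_{22}^2Gz$ denotes the family $(x,y,z)\mapsto\nabla_{22}^2G_j(x,y)z$, and similarly for $\nabla_{12}^2Gz$. The directions are $$v_k^y=\mathcal M_g(\nabla_2G,k),\quad v_k^z=\mathcal M_g(\nabla_{22}^2Gz,k)-\mathcal M_f(\nabla_2F,k),$$ $$D_k^x=\mathcal M_f(\nabla_1F,k)-\mathcal M_g(\nabla_{12}^2Gz,k),\quad v_k^x=(1-\rho_{k-1})v_{k-1}^x+\rho_{k-1}D_{k-1}^x,$$ and the updates are $x_{k+1}=x_k-\alpha_kv_k^x$, $y_{k+1}=y_k-\beta_kv_k^y$, $z_{k+1}=z_k-\gamma_kv_k^z$. The memories are updated by $w_{k+1,i_k}=(x_k,y_k,z_k)$, $w_{k+1,i}=w_{k,i}$ for $i\ne i_k$, and analogously for the memories attached to $g$ with $j_k$.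
   Formalization: H is additionally assumed bounded below; otherwise f(x,y)=<a,x>, g(x,y)=|y|^2/2 is a counterexample, as the gradient of H is constant. The O-constant depends on a bound for H(x_0)-inf H and for the initial points, direction and memories. *)

(* Defs.v *)
From HB Require Import structures.
From mathcomp Require Import all_boot all_order all_algebra.
From mathcomp Require Import all_classical all_reals all_analysis.

Set Implicit Arguments.
Unset Strict Implicit.
Unset Printing Implicit Defensive.

Import Order.TTheory GRing.Theory Num.Theory.
Import numFieldNormedType.Exports.

Local Open Scope classical_set_scope.
Local Open Scope ring_scope.

Section Calculus.
Variable R : realType.

(* The library norm `|v| on matrices is the sup norm, whence the following. *)
Definition enorm (d : nat) (v : 'cV[R]_d) : R :=
  Num.sqrt (\sum_(i < d) v i 0 ^+ 2).

Definition opnorm (d e : nat) (A : 'M[R]_(d, e)) : R :=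
  sup [set enorm (A *m u) | u in [set u : 'cV[R]_e | enorm u <= 1]].

Definition grad (d : nat) (f : 'cV[R]_d -> R) (p : 'cV[R]_d) : 'cV[R]_d :=
  \col_i 'D_(delta_mx i 0) f p.

Definition hess (d : nat) (f : 'cV[R]_d -> R) (p : 'cV[R]_d) : 'M[R]_d :=
  \matrix_(i, j) 'D_(delta_mx j 0) (fun q => 'D_(delta_mx i 0) f q) p.

Definition twice_differentiable (d : nat) (f : 'cV[R]_d -> R) : Prop :=
  (forall p, differentiable f p) /\ (forall p, differentiable (grad f) p).

Definition grad_lipschitz (d : nat) (L : R) (f : 'cV[R]_d -> R) : Prop :=
  forall p q, enorm (grad f p - grad f q) <= L * enorm (p - q).

Definition hess_lipschitz (d : nat) (L : R) (f : 'cV[R]_d -> R) : Prop :=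
  forall p q, opnorm (hess f p - hess f q) <= L * enorm (p - q).

Definition strongly_convex (d : nat) (mu : R) (h : 'cV[R]_d -> R) : Prop :=
  forall (u v : 'cV[R]_d) (t : R), 0 <= t -> t <= 1 ->
    h (t *: u + (1 - t) *: v) <=
      t * h u + (1 - t) * h v - mu / 2 * t * (1 - t) * enorm (u - v) ^+ 2.

Definition is_argmin (d : nat) (h : 'cV[R]_d -> R) (u : 'cV[R]_d) : Prop :=
  forall v, h u <= h v.

Definition avg (n d : nat) (F : 'I_n -> 'cV[R]_d -> R) (p : 'cV[R]_d) : R :=
  n%:R^-1 * \sum_(i < n) F i p.

(* A function of (x, y) is a function of the stacked vector col_mx x y. *)
Section Blocks.
Variables dx dy : nat.
Implicit Types (f : 'cV[R]_(dx + dy) -> R) (p : 'cV[R]_(dx + dy)).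

Definition grad1 f p : 'cV[R]_dx := usubmx (grad f p).
Definition grad2 f p : 'cV[R]_dy := dsubmx (grad f p).
Definition hess12 f p : 'M[R]_(dx, dy) := ursubmx (hess f p).
Definition hess22 f p : 'M[R]_dy := drsubmx (hess f p).

Definition upper_value f (ystar : 'cV[R]_dx -> 'cV[R]_dy) (x : 'cV[R]_dx) : R :=
  f (col_mx x (ystar x)).

End Blocks.
End Calculus.

Section Algorithm.
Variables (R : realType) (dx dy n m : nat).
Variables (F : 'I_n -> 'cV[R]_(dx + dy) -> R) (G : 'I_m -> 'cV[R]_(dx + dy) -> R).

Record triple := Triple {
  px : 'cV[R]_dx;
  py : 'cV[R]_dy;
  pz : 'cV[R]_dy }.

Definition pxy (p : triple) : 'cV[R]_(dx + dy) := col_mx (px p) (py p).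

Definition pdist (p q : triple) : R :=
  enorm (col_mx (pxy p - pxy q) (pz p - pz q)).

Definition saga (s d : nat) (phi : 'I_s -> triple -> 'cV[R]_d)
    (w : 'I_s -> triple) (l : 'I_s) (p : triple) : 'cV[R]_d :=
  phi l p - phi l (w l) + s%:R^-1 *: \sum_(i < s) phi i (w i).

Definition remember (s : nat) (w : 'I_s -> triple) (l : 'I_s) (p : triple) :
    'I_s -> triple :=
  fun i => if i == l then p else w i.

Definition dir_y (wg : 'I_m -> triple) (j : 'I_m) (p : triple) : 'cV[R]_dy :=
  saga (fun j p => grad2 (G j) (pxy p)) wg j p.

Definition dir_z (wf : 'I_n -> triple) (wg : 'I_m -> triple)
    (i : 'I_n) (j : 'I_m) (p : triple) : 'cV[R]_dy :=
  saga (fun j p => hess22 (G j) (pxy p) *m pz p) wg j p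
  - saga (fun i p => grad2 (F i) (pxy p)) wf i p.

Definition dir_x (wf : 'I_n -> triple) (wg : 'I_m -> triple)
    (i : 'I_n) (j : 'I_m) (p : triple) : 'cV[R]_dx :=
  saga (fun i p => grad1 (F i) (pxy p)) wf i p
  - saga (fun j p => hess12 (G j) (pxy p) *m pz p) wg j p.

(* The state at iteration k: the iterate (x_k, y_k, z_k), the direction v_k^x
   and the two memories w_k. *)
Record saba_state := SabaState {
  cur : triple;
  vx : 'cV[R]_dx;
  memf : 'I_n -> triple;
  memg : 'I_m -> triple }.

Definition momentum_step (rho : R) (i : 'I_n) (j : 'I_m)
    (s : saba_state) : 'cV[R]_dx :=
  (1 - rho) *: vx s + rho *: dir_x (memf s) (memg s) i j (cur s).

Definition saba_step (alpha beta gamma rho : R) (i : 'I_n) (j : 'I_m)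
    (s : saba_state) : saba_state :=
  let p := cur s in
  SabaState
    (Triple (px p - alpha *: vx s)
            (py p - beta *: dir_y (memg s) j p)
            (pz p - gamma *: dir_z (memf s) (memg s) i j p))
    (momentum_step rho i j s)
    (remember (memf s) i p)
    (remember (memg s) j p).

(* Passage from iteration -1 to iteration 0: as in [saba_step], except that the
   iterate (x_0, y_0, z_0) is an input. *)
Definition first_step (p0 : triple) (rho : R) (i : 'I_n) (j : 'I_m)
    (s : saba_state) : saba_state :=
  SabaState p0 (momentum_step rho i j s)
    (remember (memf s) i (cur s)) (remember (memg s) j (cur s)).

(* [ma_saba ... k] is the state at iteration k >= 0. Since iteration -1 also
   uses a momentum parameter and a pair of indices, rho, i and j are shifted by
   one: rho t, i t and j t stand for rho_{t-1}, i_{t-1} and j_{t-1}. *)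
Fixpoint ma_saba (sm1 : saba_state) (p0 : triple) (alpha beta gamma rho : nat -> R)
    (i : nat -> 'I_n) (j : nat -> 'I_m) (k : nat) : saba_state :=
  if k is k'.+1 then
    saba_step (alpha k') (beta k') (gamma k') (rho k) (i k) (j k)
      (ma_saba sm1 p0 alpha beta gamma rho i j k')
  else first_step p0 (rho 0%N) (i 0%N) (j 0%N) sm1.

End Algorithm.

Section Sampling.
Context (R : realType) (d : measure_display) (T : measurableType d).
Variables (P : probability T R) (n m : nat).
Variables (I : nat -> T -> 'I_n) (J : nat -> T -> 'I_m).

Definition uniform_index (s : nat) (X : T -> 'I_s) : Prop :=
  forall a, measurable (X @^-1` [set a]) /\ P (X @^-1` [set a]) = (s%:R^-1)%:E.

(* Taking some of the A t, B t to be setT gives the product rule for every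
   finite subfamily. *)
Definition independent_indices : Prop :=
  forall (N : nat) (A : nat -> set 'I_n) (B : nat -> set 'I_m),
    P (\bigcap_(t in [set t | (t < N)%N]) (I t @^-1` A t `&` J t @^-1` B t)) =
    (\prod_(t < N) (P (I t @^-1` A t) * P (J t @^-1` B t)))%E.

Definition independent_uniform_indices : Prop :=
  [/\ forall t, uniform_index (I t), forall t, uniform_index (J t)
    & independent_indices].

End Sampling.

(* Main.v *)
Require Import Defs.
From mathcomp Require Import all_boot all_order all_algebra.
From mathcomp Require Import all_classical all_reals all_analysis measurable_realfun.
From mathcomp Require Import ring lra.

Set Implicit Arguments.
Unset Strict Implicit.
Unset Printing Implicit Defensive.

Import Order.TTheory GRing.Theory Num.Theory.
Import numFieldNormedType.Exports.

Local Open Scope ring_scope.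

(** The gradient of [H x = f (x, ystar x)] comes from differentiating under the
constraint [grad_2 g (x, ystar x) = 0]. With the multiplier [zstar x] that solves
[hess22 g z = grad_2 f] at [(x, ystar x)], this hypergradient is the [x]-block of the gradient
in [(x, y)] of the Lagrangian [f - <z, grad_2 g>], whose [y]-block vanishes there
([grad_upper_value]). The point [(ystar x, zstar x)] and the hypergradient are
Lipschitz in [x], because [hess22 g >= mu] and [zstar] is bounded by [Cf / mu].
The algorithm runs three coupled recursions: [y] follows [ystar x], [z] follows
[zstar x], and the velocity [v] is a moving average of estimates of the
hypergradient; [x] moves along [- v].

Each step has the same shape. Write [u = |v|^2], and [V], [Y], [Z] for the squared
errors of [v], [y], [z], and [W] for the mean squared distance of the memories to
the current iterate. In expectation, [V], [Y], [Z] contract by [1 - c eta] up to a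
drift [alpha^2 / eta * u] of their targets, up to each other, and up to noise
[eta^2 W] ([err_v_step], [err_y_step], [err_z_step]); the noise is proportional to
[W] because the estimators are exact when the memories are current
([variance_saga]). The maps [hess G_j z] are not Lipschitz, as [z] is not bounded
along the iterates. This is repaired by writing [z = zstar + (z - zstar)]: the
first part is bounded, and the second contributes a multiple of [Z], which the
contraction of [Z] absorbs ([hessGz_lipschitz]).

The memories contract by [1 - 1 / (2 N)] with [N = n + m], against a displacement
whose mean costs a factor [N] and whose centred noise costs only a constant
([mem_error_step]). This distinction allows the large steps
[alpha, eta] of order [q = N^(-2/3)]: in the Lyapunov function
[H + eps (V + b_y Y + b_z Z + l W)] the weight [l] of order [N q^2] is enough for
[l / N] to pay the noise [eta^2], and then the displacement costs
[l N eta^2], of order [N^2 q^4 = q], which is what the contractions and the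
descent of [H] can pay ([lyapunov_step], [lyapunov_decrease]). Each step thus
decreases the function by [alpha / 2 * |grad H|^2] in expectation, its initial value is
bounded by the initial data ([lyapunov_init]), and telescoping gives the rate
[1 / (alpha K)], of order [N^(2/3) / K].

The iterate [x_k] depends on finitely many independent uniform indices, so its
expectations are finite averages over histories of index pairs
([expectation_history]); all the estimates are made on such averages. *)

(** * Euclidean geometry of column vectors *)

Section Euclidean.
Variable R : realType.

Definition dot (d : nat) (u v : 'cV[R]_d) : R := \sum_i u i 0 * v i 0.

Section Dot.
Variable d : nat.
Implicit Types u v w : 'cV[R]_d.

Lemma dotC u v : dot u v = dot v u.
Proof. by apply: eq_bigr => i _; rewrite mulrC. Qed.

Lemma dotDl u v w : dot (u + v) w = dot u w + dot v w.
Proof.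
by rewrite /dot -big_split; apply: eq_bigr => i _; rewrite !mxE mulrDl.
Qed.

Lemma dotZl a u v : dot (a *: u) v = a * dot u v.
Proof. by rewrite /dot mulr_sumr; apply: eq_bigr => i _; rewrite !mxE mulrA. Qed.

Lemma dotNl u v : dot (- u) v = - dot u v.
Proof. by rewrite -scaleN1r dotZl mulN1r. Qed.

Lemma dot0l u : dot 0 u = 0.
Proof. by rewrite -(scale0r 0) dotZl mul0r. Qed.

Lemma dotDr u v w : dot w (u + v) = dot w u + dot w v.
Proof. by rewrite dotC dotDl !(dotC w). Qed.

Lemma dotZr a u v : dot u (a *: v) = a * dot u v.
Proof. by rewrite dotC dotZl dotC. Qed.

Lemma dotNr u v : dot u (- v) = - dot u v.
Proof. by rewrite dotC dotNl dotC. Qed.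

Lemma dot0r u : dot u 0 = 0.
Proof. by rewrite dotC dot0l. Qed.

Lemma dot_suml (I : finType) (X : I -> 'cV[R]_d) v :
  dot (\sum_i X i) v = \sum_i dot (X i) v.
Proof.
elim/big_ind2 : _ => [|x1 x2 y1 y2 <- <-|//]; first by rewrite dot0l.
by rewrite dotDl.
Qed.

Definition dotE := (dotDl, dotDr, dotNl, dotNr, dotZl, dotZr, dot0l, dot0r).

Lemma enorm_sqr v : enorm v ^+ 2 = dot v v.
Proof.
rewrite /enorm sqr_sqrtr; last by apply: sumr_ge0 => i _; rewrite sqr_ge0.
by apply: eq_bigr => i _; rewrite expr2.
Qed.

Lemma enorm_ge0 v : 0 <= enorm v. Proof. exact: sqrtr_ge0. Qed.
Hint Resolve enorm_ge0 : core.

Lemma dot_ge0 v : 0 <= dot v v. Proof. by rewrite -enorm_sqr sqr_ge0. Qed.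

Lemma enorm_eq0 v : enorm v = 0 -> v = 0.
Proof.
move=> v0; have /eqP : dot v v = 0 by rewrite -enorm_sqr v0 expr0n.
rewrite psumr_eq0 => [/allP/= e|i _]; last by rewrite -expr2 sqr_ge0.
apply/colP => i; rewrite mxE; apply/eqP.
by move: (e i); rewrite mem_index_enum => /(_ isT); rewrite mulf_eq0 orbb.
Qed.

Lemma enorm0 : enorm (0 : 'cV[R]_d) = 0.
Proof. by apply/eqP; rewrite -sqrf_eq0 enorm_sqr dot0l. Qed.

Lemma enorm_le v a : 0 <= a -> (enorm v <= a) = (dot v v <= a ^+ 2).
Proof. by move=> a0; rewrite -enorm_sqr ler_sqr ?nnegrE. Qed.

Lemma enormZ a v : enorm (a *: v) = `|a| * enorm v.
Proof.
apply/eqP; rewrite -(eqrXn2 (n := 2)) ?mulr_ge0//.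
by rewrite exprMn !enorm_sqr !dotE real_normK ?num_real//; apply/eqP; ring.
Qed.

Lemma sqr_enormZ a v : enorm (a *: v) ^+ 2 = a ^+ 2 * enorm v ^+ 2.
Proof. by rewrite enormZ exprMn real_normK ?num_real. Qed.

Lemma enormN v : enorm (- v) = enorm v.
Proof. by rewrite -scaleN1r enormZ normrN1 mul1r. Qed.

Lemma enormC u v : enorm (u - v) = enorm (v - u).
Proof. by rewrite -enormN opprB. Qed.


Lemma dot_le u v : dot u v <= enorm u * enorm v.
Proof.
have [u0|u0] := eqVneq (enorm u) 0.
  by rewrite u0 (enorm_eq0 u0) dot0l mul0r.
have [v0|v0] := eqVneq (enorm v) 0.
  by rewrite v0 (enorm_eq0 v0) dot0r mulr0.
have uv : 0 < enorm u * enorm v by rewrite mulr_gt0// lt_neqAle eq_sym ?u0 ?v0 /=.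
have := dot_ge0 (enorm v *: u - enorm u *: v).
move=> h; rewrite !dotE -!enorm_sqr (dotC v u) in h *; rewrite -(ler_pM2l uv); nra.
Qed.

Lemma dot_abs u v : `|dot u v| <= enorm u * enorm v.
Proof. by rewrite ler_norml dot_le lerNl -dotNl -(enormN u) dot_le. Qed.

Lemma enormD u v : enorm (u + v) <= enorm u + enorm v.
Proof.
rewrite enorm_le ?addr_ge0// !dotE -!enorm_sqr (dotC v u).
by have := dot_le u v; lra.
Qed.

Lemma enormB u v : enorm (u - v) <= enorm u + enorm v.
Proof. by rewrite -(enormN v) enormD. Qed.

Lemma enorm_dist w u v : enorm (u - v) <= enorm (u - w) + enorm (w - v).
Proof. by rewrite -[u - v](subrKA w) enormD. Qed.

Lemma sqr_enormD u v :
  enorm (u + v) ^+ 2 = enorm u ^+ 2 + (2 * dot v u + enorm v ^+ 2).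
Proof. by rewrite !enorm_sqr !dotE (dotC v); ring. Qed.

Lemma sqr_enormD2 u v :
  enorm (u + v) ^+ 2 <= 2 * enorm u ^+ 2 + 2 * enorm v ^+ 2.
Proof.
have := dot_ge0 (u - v); move=> h; rewrite !enorm_sqr !dotE (dotC v u) in h *; lra.
Qed.

Lemma sqr_enormZD2 a u v :
  enorm (a *: u + v) ^+ 2 <= 2 * (a ^+ 2 * enorm u ^+ 2) + 2 * enorm v ^+ 2.
Proof. by rewrite -sqr_enormZ sqr_enormD2. Qed.

Lemma sqr_enorm_subZ a u v : enorm (u - a *: v) ^+ 2 =
  enorm u ^+ 2 - 2 * (a * dot v u) + a ^+ 2 * enorm v ^+ 2.
Proof. by rewrite sqr_enormD dotNl dotZl enormN sqr_enormZ; ring. Qed.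

(** Young's inequality in the form that trades a perturbation against a slightly
worse contraction factor. *)
Lemma sqr_enormD_young t u v : 0 < t ->
  enorm (u + v) ^+ 2 <= (1 + t) * enorm u ^+ 2 + (1 + t^-1) * enorm v ^+ 2.
Proof.
move=> t0; have := dot_ge0 (t *: u - v).
rewrite !enorm_sqr !dotE (dotC v u) => h.
have : 0 <= t^-1 * (t * (t * dot u u) - t * dot u v + (- (t * dot u v) + - - dot v v)).
  by rewrite mulr_ge0 ?invr_ge0 ?(ltW t0)//; lra.
have -> : t^-1 * (t * (t * dot u u) - t * dot u v +
    (- (t * dot u v) + - - dot v v)) =
    t * dot u u - 2 * dot u v + t^-1 * dot v v by field; lra.
by lra.
Qed.

(** Convexity of the squared norm, with the second point rescaled. *)
Lemma sqr_enorm_convex t u v : 0 < t -> t <= 1 ->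
  enorm ((1 - t) *: u + v) ^+ 2 <= (1 - t) * enorm u ^+ 2 + t^-1 * enorm v ^+ 2.
Proof.
move=> t0 t1; have := dot_ge0 (t *: u - v).
have [it0 tit] : 0 < t^-1 /\ t * t^-1 = 1 by rewrite invr_gt0 divff ?gt_eqF.
rewrite !enorm_sqr !dotE (dotC v u) => h.
have h2 : 0 <= (t^-1 - 1) * (t * (t * dot u u) - t * dot u v +
    (- (t * dot u v) + - - dot v v)).
  by rewrite mulr_ge0 ?subr_ge0 ?invf_ge1 //; lra.
have : (t^-1 - 1) * (t * (t * dot u u) - t * dot u v +
    (- (t * dot u v) + - - dot v v)) =
  (1 - t) * t * dot u u - 2 * (1 - t) * dot u v + (t^-1 - 1) * dot v v.
  by field; lra.
lra.
Qed.

End Dot.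

#[local] Hint Resolve enorm_ge0 : core.

Lemma dot_col_mx d e (a c : 'cV[R]_d) (b f : 'cV[R]_e) :
  dot (col_mx a b) (col_mx c f) = dot a c + dot b f.
Proof.
rewrite /dot big_split_ord; congr (_ + _); apply: eq_bigr => i _.
  by rewrite !col_mxEu.
by rewrite !col_mxEd.
Qed.

Lemma sqr_enorm_col_mx d e (a : 'cV[R]_d) (b : 'cV[R]_e) :
  enorm (col_mx a b) ^+ 2 = enorm a ^+ 2 + enorm b ^+ 2.
Proof. by rewrite !enorm_sqr dot_col_mx. Qed.

Lemma enorm_col_mx_le d e (a : 'cV[R]_d) (b : 'cV[R]_e) :
  enorm (col_mx a b) <= enorm a + enorm b.
Proof.
rewrite enorm_le ?addr_ge0// dot_col_mx -!enorm_sqr.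
by have : 0 <= enorm a * enorm b; [rewrite mulr_ge0|nra].
Qed.

Lemma enorm_usubmx d e (v : 'cV[R]_(d + e)) : enorm (usubmx v) <= enorm v.
Proof.
by rewrite enorm_le// -enorm_sqr -[in leRHS](vsubmxK v) sqr_enorm_col_mx
  lerDl sqr_ge0.
Qed.

Lemma enorm_dsubmx d e (v : 'cV[R]_(d + e)) : enorm (dsubmx v) <= enorm v.
Proof.
by rewrite enorm_le// -enorm_sqr -[in leRHS](vsubmxK v) sqr_enorm_col_mx
  lerDr sqr_ge0.
Qed.

Lemma enorm_col_mx0 d e (a : 'cV[R]_d) : enorm (col_mx a (0 : 'cV_e)) = enorm a.
Proof.
by apply/eqP; rewrite -(eqrXn2 (n := 2))// sqr_enorm_col_mx enorm0 expr0n addr0.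
Qed.

Lemma enorm_col_0mx d e (a : 'cV[R]_d) : enorm (col_mx (0 : 'cV_e) a) = enorm a.
Proof.
by apply/eqP; rewrite -(eqrXn2 (n := 2))// sqr_enorm_col_mx enorm0 expr0n add0r.
Qed.

Lemma col_mxB d e (a c : 'cV[R]_d) (b f : 'cV[R]_e) :
  col_mx a b - col_mx c f = col_mx (a - c) (b - f).
Proof. by rewrite opp_col_mx add_col_mx. Qed.

Lemma usubmxB d e (u v : 'cV[R]_(d + e)) : usubmx (u - v) = usubmx u - usubmx v.
Proof. exact: linearB. Qed.

Lemma dsubmxB d e (u v : 'cV[R]_(d + e)) : dsubmx (u - v) = dsubmx u - dsubmx v.
Proof. exact: linearB. Qed.

Lemma enorm_mulmx_le d e (A : 'M[R]_(d, e)) :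
  exists2 C, 0 <= C & forall u, enorm (A *m u) <= C * enorm u.
Proof.
exists (Num.sqrt (\sum_i enorm (row i A)^T ^+ 2)) => [|u]; first exact: sqrtr_ge0.
rewrite enorm_le ?mulr_ge0 ?sqrtr_ge0// exprMn sqr_sqrtr; last first.
  by apply: sumr_ge0 => i _; rewrite sqr_ge0.
rewrite mulr_suml; apply: ler_sum => i _.
have -> : (A *m u) i 0 = dot (row i A)^T u.
  by rewrite mxE; apply: eq_bigr => j _; rewrite !mxE.
rewrite -expr2 -exprMn -[leLHS]real_normK ?num_real// lerXn2r ?nnegrE ?mulr_ge0//.
exact: dot_abs.
Qed.

Lemma enorm_mulmx d e (A : 'M[R]_(d, e)) u : enorm (A *m u) <= opnorm A * enorm u.
Proof.
have [C C0 AC] := enorm_mulmx_le A.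
have [u0|u0] := eqVneq (enorm u) 0.
  by rewrite u0 (enorm_eq0 u0) mulmx0 enorm0 mulr0.
have up : 0 < enorm u by rewrite lt_neqAle eq_sym u0 /=.
rewrite -ler_pdivrMr//.
have -> : enorm (A *m u) / enorm u = enorm (A *m ((enorm u)^-1 *: u)).
  by rewrite -scalemxAr enormZ gtr0_norm ?invr_gt0// mulrC.
apply: (@ub_le_sup R) => /=; last first.
  by exists ((enorm u)^-1 *: u) => //=; rewrite enormZ gtr0_norm ?invr_gt0// mulVf.
exists C => _ /= [v v1 <-]; apply: le_trans (AC v) _.
by rewrite -[leRHS]mulr1 ler_wpM2l.
Qed.

Lemma opnorm_ge0 d e (A : 'M[R]_(d, e)) : 0 <= opnorm A.
Proof.
have [C C0 AC] := enorm_mulmx_le A.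
apply: (@ub_le_sup R) => /=; last first.
  by exists 0 => /=; rewrite ?mulmx0 enorm0.
exists C => _ /= [v v1 <-]; apply: le_trans (AC v) _.
by rewrite -[leRHS]mulr1 ler_wpM2l.
Qed.

End Euclidean.
#[global] Hint Extern 0 (is_true (0 <= enorm _)) => exact: enorm_ge0 : core.

(** * Uniform averages and the variance-reduced estimators *)

Section Averages.
Variable R : realType.

Definition mean (T : finType) (X : T -> R) : R := #|T|%:R^-1 * \sum_t X t.

Definition vmean (T : finType) (d : nat) (X : T -> 'cV[R]_d) : 'cV[R]_d :=
  #|T|%:R^-1 *: \sum_t X t.

Section Mean.
Variable T : finType.
Hypothesis T0 : (0 < #|T|)%N.
Implicit Types X Y : T -> R.

Let card_neq0 : #|T|%:R != 0 :> R. Proof. by rewrite pnatr_eq0 -lt0n. Qed.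

Lemma eq_mean X Y : X =1 Y -> mean X = mean Y.
Proof. by move=> XY; congr (_ * _); apply: eq_bigr => t _; rewrite XY. Qed.

Lemma mean_cst c : mean (fun _ : T => c) = c.
Proof. by rewrite /mean sumr_const -[c *+ _]mulr_natl mulKf. Qed.

Lemma meanD X Y : mean (fun t => X t + Y t) = mean X + mean Y.
Proof. by rewrite /mean big_split mulrDr. Qed.

Lemma meanZ c X : mean (fun t => c * X t) = c * mean X.
Proof. by rewrite /mean -mulr_sumr mulrCA. Qed.

Lemma meanN X : mean (fun t => - X t) = - mean X.
Proof. by rewrite /mean sumrN mulrN. Qed.

Lemma mean_le X Y : (forall t, X t <= Y t) -> mean X <= mean Y.
Proof. by move=> XY; rewrite ler_wpM2l ?invr_ge0 ?ler0n// ler_sum. Qed.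

Lemma mean_ge0 X : (forall t, 0 <= X t) -> 0 <= mean X.
Proof. by move=> X0; rewrite mulr_ge0 ?invr_ge0 ?ler0n// sumr_ge0. Qed.

Lemma mean_le_cst X c : (forall t, X t <= c) -> mean X <= c.
Proof. by move=> Xc; rewrite -[leRHS]mean_cst mean_le. Qed.

Section Vector.
Variable d : nat.
Implicit Types U V : T -> 'cV[R]_d.

Lemma eq_vmean U V : U =1 V -> vmean U = vmean V.
Proof. by move=> UV; congr (_ *: _); apply: eq_bigr => t _; rewrite UV. Qed.

Lemma vmean_cst c : vmean (fun _ : T => c : 'cV[R]_d) = c.
Proof. by rewrite /vmean sumr_const -[c *+ _]scaler_nat scalerA mulVf// scale1r. Qed.

Lemma vmeanD U V : vmean (fun t => U t + V t) = vmean U + vmean V.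
Proof. by rewrite /vmean big_split scalerDr. Qed.

Lemma vmeanN U : vmean (fun t => - U t) = - vmean U.
Proof. by rewrite /vmean sumrN scalerN. Qed.

Lemma vmeanB U V : vmean (fun t => U t - V t) = vmean U - vmean V.
Proof. by rewrite vmeanD vmeanN. Qed.

Lemma vmeanZ c U : vmean (fun t => c *: U t) = c *: vmean U.
Proof. by rewrite /vmean -scaler_sumr !scalerA mulrC. Qed.

Lemma dot_vmean U v : dot (vmean U) v = mean (fun t => dot (U t) v).
Proof. by rewrite /vmean dotZl dot_suml. Qed.

(** The cross term averages to zero, so centred noise adds to the mean without
interacting with it. *)
Lemma mean_sqr_center c a U :
  mean (fun t => enorm (c + a *: (U t - vmean U)) ^+ 2) =
  enorm c ^+ 2 + a ^+ 2 * mean (fun t => enorm (U t - vmean U) ^+ 2).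
Proof.
have -> : mean (fun t => enorm (c + a *: (U t - vmean U)) ^+ 2) =
  mean (fun t => enorm c ^+ 2 + (2 * a * dot (U t - vmean U) c
    + a ^+ 2 * enorm (U t - vmean U) ^+ 2)).
  apply: eq_mean => t; rewrite !enorm_sqr; move: (U t - _) => D; rewrite !dotE (dotC c).
  by ring.
rewrite !meanD mean_cst !meanZ -dot_vmean vmeanB vmean_cst subrr dot0l.
by rewrite mulr0 add0r.
Qed.

Lemma mean_sqr U : mean (fun t => enorm (U t) ^+ 2) =
  enorm (vmean U) ^+ 2 + mean (fun t => enorm (U t - vmean U) ^+ 2).
Proof.
have := mean_sqr_center (vmean U) 1 U; rewrite expr1n mul1r => <-.
by apply: eq_mean => t; rewrite scale1r subrKC.
Qed.

Lemma sqr_vmean_le U : enorm (vmean U) ^+ 2 <= mean (fun t => enorm (U t) ^+ 2).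
Proof. by rewrite mean_sqr lerDl mean_ge0// => t; rewrite sqr_ge0. Qed.

(** The mean minimises the mean squared distance, hence any centre bounds the
variance. *)
Lemma variance_le c U : mean (fun t => enorm (U t - vmean U) ^+ 2) <=
  mean (fun t => enorm (U t - c) ^+ 2).
Proof.
rewrite (mean_sqr (fun t => U t - c)) vmeanB vmean_cst.
rewrite [X in _ <= _ + X](_ : _ = mean (fun t => enorm (U t - vmean U) ^+ 2)).
  by rewrite lerDr sqr_ge0.
by apply: eq_mean => t; rewrite opprB addrA subrK.
Qed.

Lemma enorm_vmean_le U : enorm (vmean U) <= mean (fun t => enorm (U t)).
Proof.
rewrite /vmean enormZ ger0_norm ?invr_ge0 ?ler0n// ler_wpM2l ?invr_ge0 ?ler0n//.
elim/big_ind2 : _ => [|x1 x2 y1 y2 h1 h2|//]; first by rewrite enorm0.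
by apply: le_trans (enormD _ _) _; exact: lerD.
Qed.

End Vector.
End Mean.

Section Product.
Variables S T : finType.
Hypotheses (S0 : (0 < #|S|)%N) (T0 : (0 < #|T|)%N).

Lemma card_pair_gt0 : (0 < #|{: S * T}|)%N.
Proof. by rewrite card_prod muln_gt0 S0. Qed.

Lemma mean_pair (X : S * T -> R) : mean X = mean (fun s => mean (fun t => X (s, t))).
Proof.
rewrite /mean -mulr_sumr mulrA card_prod natrM invfM; congr (_ * _).
by rewrite pair_bigA; apply: eq_bigr => -[].
Qed.

Lemma mean_fst (X : S -> R) : mean (fun l : S * T => X l.1) = mean X.
Proof. by rewrite mean_pair; apply: eq_mean => s; rewrite /= mean_cst. Qed.

Lemma mean_snd (X : T -> R) : mean (fun l : S * T => X l.2) = mean X.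
Proof. by rewrite mean_pair /= (mean_cst S0). Qed.

Lemma vmean_fst d (X : S -> 'cV[R]_d) : vmean (fun l : S * T => X l.1) = vmean X.
Proof.
apply/colP => i; rewrite /vmean !mxE !summxE; exact: (mean_fst (fun s => X s i 0)).
Qed.

Lemma vmean_snd d (X : T -> 'cV[R]_d) : vmean (fun l : S * T => X l.2) = vmean X.
Proof.
apply/colP => i; rewrite /vmean !mxE !summxE; exact: (mean_snd (fun s => X s i 0)).
Qed.

End Product.

Section Saga.
Variables (dx dy s d : nat) (phi : 'I_s -> triple R dx dy -> 'cV[R]_d).
Variables (w : 'I_s -> triple R dx dy) (p : triple R dx dy).
Hypothesis s0 : (0 < s)%N.

Let Is0 : (0 < #|'I_s|)%N. Proof. by rewrite card_ord. Qed.

Lemma sagaE l :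
  saga phi w l p = phi l p - phi l (w l) + vmean (fun i => phi i (w i)).
Proof. by rewrite /vmean card_ord. Qed.

(** The memory terms cancel on average, so the estimator is unbiased whatever the
memories contain. *)
Lemma vmean_saga : vmean (fun l => saga phi w l p) = vmean (phi^~ p).
Proof.
under eq_vmean do rewrite sagaE.
by rewrite vmeanD vmeanB vmean_cst // subrK.
Qed.

(** The estimator is the uncentred difference plus a constant, so its variance is
at most the second moment of that difference: it vanishes when the memories
agree with the current point. *)
Lemma variance_saga : mean (fun l => enorm (saga phi w l p - vmean (phi^~ p)) ^+ 2)
  <= mean (fun l => enorm (phi l p - phi l (w l)) ^+ 2).
Proof.
rewrite -vmean_saga.
apply: le_trans (variance_le Is0 (vmean (fun i => phi i (w i))) _) _.
by apply: mean_le => l; rewrite sagaE addrK.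
Qed.

End Saga.
End Averages.

(** * Derivatives along lines, Taylor bounds, symmetry of the Hessian *)

Section Calculus.
Variable R : realType.
Local Open Scope classical_set_scope.
Local Open Scope ring_scope.

(** Passage to the limit [t -> 0] in an inequality between affine functions. *)
Lemma le_of_le_small (a b c : R) :
  (forall t, 0 < t -> t <= 1 -> a <= b + t * c) -> a <= b.
Proof.
move=> h; rewrite leNgt; apply/negP => ba.
have D0 : 0 < (a - b) + `|c| + 1 by have := normr_ge0 c; lra.
have t0 : 0 < (a - b) / ((a - b) + `|c| + 1) by rewrite divr_gt0// subr_gt0.
have t1 : (a - b) / ((a - b) + `|c| + 1) <= 1.
  by rewrite ler_pdivrMr// mul1r; have := normr_ge0 c; lra.
have := h _ t0 t1; apply/negP; rewrite -ltNge -ltrBrDl.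
apply: le_lt_trans (ler_wpM2l (ltW t0) (ler_norm c)) _.
rewrite mulrAC ltr_pdivrMr// ltr_pM2l ?subr_gt0//; lra.
Qed.

Section Gradient.
Variable d : nat.
Implicit Types (f : 'cV[R]_d -> R) (p q u v w : 'cV[R]_d).

(** The differential is linear, hence determined by the partial derivatives. *)
Lemma derive_grad f p v : differentiable f p -> 'D_v f p = dot (grad f p) v.
Proof.
move=> df; rewrite deriveE// [in LHS](_ : v = \sum_i v i 0 *: delta_mx i 0).
  rewrite linear_sum; apply: eq_bigr => i _.
  by rewrite linearZ/= mxE deriveE// mulrC.
by rewrite [LHS]matrix_sum_delta; apply: eq_bigr => i _; rewrite big_ord1.
Qed.

Lemma is_derive_line f p v (t : R) : differentiable f (p + t *: v) ->
  is_derive t (1 : R) (fun s : R => f (p + s *: v)) (dot (grad f (p + t *: v)) v).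
Proof.
move=> df; have [dv ev] := derivableP (diff_derivable (v := v) df).
have eqf : (fun h : R => h^-1 *:
      (((fun s => f (p + s *: v)) \o shift t) (h *: 1) - f (p + t *: v))) =
    (fun h => h^-1 *: ((f \o shift (p + t *: v)) (h *: v) - f (p + t *: v))).
  apply/funext => h /=; congr (_ *: (f _ - _)).
  by rewrite [h *: 1]mulr1 scalerDl addrCA.
split; first by rewrite /derivable eqf.
by rewrite /derive eqf -derive_grad.
Qed.

Lemma MVT_line f p v : (forall q, differentiable f q) ->
  exists t, [/\ 0 <= t, t <= 1 & f (p + v) - f p = dot (grad f (p + t *: v)) v].
Proof.
move=> df.
pose phi s := f (p + s *: v); pose dphi s := dot (grad f (p + s *: v)) v.
have dp s : is_derive s (1 : R) phi (dphi s) by exact: is_derive_line.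
have cphi : {within `[0, 1]%classic, continuous phi}.
  apply: continuous_subspaceT => s; apply: differentiable_continuous.
  by apply/derivable1_diffP; exact: ex_derive.
have [t t01] := MVT ltr01 (fun s _ => dp s) cphi.
rewrite /phi /dphi scale1r scale0r addr0 subr0 mulr1 => e.
by exists t; split => //; move: t01; rewrite in_itv/= => /andP[/ltW + /ltW].
Qed.

(** The gradient varies by at most [L] times the displacement on the segment, so
by the mean value theorem the first-order error is quadratic. *)
Lemma grad_lipschitz_quadratic L f p q : (forall r, differentiable f r) ->
  grad_lipschitz L f -> 0 <= L ->
  `|f q - f p - dot (grad f p) (q - p)| <= L * enorm (q - p) ^+ 2.
Proof.
move=> df lf L0; have [t [t0 t1]] := MVT_line p (q - p) df.
rewrite subrKC => ->; rewrite -[- dot _ _]dotNl -dotDl.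
apply: le_trans (dot_abs _ _) _; rewrite expr2 mulrA ler_wpM2r//.
apply: (le_trans (lf _ _)); rewrite addrC addKr enormZ ger0_norm//.
by rewrite ler_wpM2l// ler_piMl.
Qed.

(** Testing the gradient against a fixed vector gives a scalar function, whose
derivatives are the entries of the Hessian combined linearly. *)
Lemma hessE f p v w : differentiable (grad f) p ->
  differentiable (fun q => dot (grad f q) w) p /\
  'D_v (fun q => dot (grad f q) w) p = dot (hess f p *m v) w.
Proof.
move=> dg; have coordE : (fun q => dot (grad f q) w) =
    \sum_(i < d) (fun q => w i 0 *: (grad f q i 0 : R)).
  by apply/funext => q; rewrite fct_sumE; apply: eq_bigr => i _; rewrite mulrC.
have dc i : differentiable (fun q => grad f q i 0 : R) p.
  exact: (differentiable_comp dg (differentiable_coord _ _ _)).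
have dwc i : differentiable (fun q => w i 0 *: (grad f q i 0 : R)) p.
  exact: differentiableZ.
rewrite coordE; split; first exact: differentiable_sum.
rewrite derive_sum => [|i]; last exact: diff_derivable.
apply: eq_bigr => i _; rewrite deriveZ//=; last exact: diff_derivable.
rewrite derive_grad// mulrC; congr (_ * _); rewrite mxE.
have -> : (fun q => grad f q i 0 : R) = (fun q => 'D_(delta_mx i 0) f q).
  by apply/funext => q; rewrite mxE.
by apply: eq_bigr => j _; rewrite !mxE.
Qed.

(** Testing the increment of the gradient against a fixed vector reduces it to a
scalar function, to which the mean value theorem applies. *)
Lemma MVT_grad f p v w : twice_differentiable f ->
  exists t, [/\ 0 <= t, t <= 1 &
    dot (grad f (p + v) - grad f p) w = dot (hess f (p + t *: v) *m v) w].
Proof.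
move=> [_ dg]; pose psi q := dot (grad f q) w.
have dpsi q : differentiable psi q by have [] := @hessE f q 0 w (dg q).
have [t [t0 t1 e]] := MVT_line p v dpsi; exists t; split => //.
by rewrite dotDl dotNl e -derive_grad//; have [] := @hessE f (p + t *: v) v w (dg _).
Qed.

(** The remainder is tested against itself, so that the mean value theorem for
scalar functions bounds its norm. *)
Lemma hess_lipschitz_quadratic L f p q : twice_differentiable f ->
  hess_lipschitz L f -> 0 <= L ->
  enorm (grad f q - grad f p - hess f p *m (q - p)) <= L * enorm (q - p) ^+ 2.
Proof.
move=> tf lf L0; set w := (X in enorm X).
have [w0|w0] := eqVneq (enorm w) 0; first by rewrite w0 mulr_ge0 ?sqr_ge0.
have wp : 0 < enorm w by rewrite lt_neqAle eq_sym w0 /=.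
have [t [t0 t1]] := MVT_grad p (q - p) w tf; rewrite subrKC => e.
have ww : enorm w * enorm w =
    dot ((hess f (p + t *: (q - p)) - hess f p) *m (q - p)) w.
  by rewrite -expr2 enorm_sqr mulmxBl [RHS]dotDl -e -dotDl.
rewrite -(ler_pM2r wp) ww.
apply: le_trans (dot_le _ _) _; rewrite ler_wpM2r// expr2 mulrA.
apply: le_trans (enorm_mulmx _ _) _; rewrite ler_wpM2r//.
apply: (le_trans (lf _ _)); rewrite addrC addKr enormZ ger0_norm//.
by rewrite ler_wpM2l// ler_piMl.
Qed.

(** Dividing the first-order expansion of the gradient by a step that tends to 0
bounds the Hessian by the Lipschitz constant of the gradient. *)
Lemma enorm_hess_le L1 L2 f p v : twice_differentiable f ->
  grad_lipschitz L1 f -> hess_lipschitz L2 f -> 0 <= L2 ->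
  enorm (hess f p *m v) <= L1 * enorm v.
Proof.
move=> tf lf lh L0; apply: (@le_of_le_small _ _ (L2 * enorm v ^+ 2)) => t t0 t1.
have tv : p + t *: v - p = t *: v by rewrite addrC addKr.
have := hess_lipschitz_quadratic p (p + t *: v) tf lh L0.
have := lf (p + t *: v) p; rewrite tv -scalemxAr enormZ gtr0_norm// => h1 h2.
rewrite -(ler_pM2l t0) -{1}(gtr0_norm t0) -enormZ.
have := enorm_dist (grad f (p + t *: v) - grad f p) (t *: (hess f p *m v)) 0.
by rewrite !subr0 enormC => h3; apply: le_trans h3 _; nra.
Qed.

(** The second difference of [f] along [s u] and [s v] is
[s^2] times the Hessian form up to [O(s^3)]. *)
Lemma second_difference L f p u v : twice_differentiable f ->
  hess_lipschitz L f -> 0 <= L -> forall s, 0 < s -> s <= 1 ->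
  `|f (p + s *: v + s *: u) - f (p + s *: u) - (f (p + s *: v) - f p)
     - s ^+ 2 * dot (hess f p *m v) u| <=
  s ^+ 3 * (2 * L * (enorm u + enorm v) ^+ 2 * enorm u).
Proof.
move=> tf lf L0 s s0 s1.
pose phi t := f (p + s *: v + t *: (s *: u)) - f (p + t *: (s *: u)).
pose dphi t := dot (grad f (p + s *: v + t *: (s *: u)) -
  grad f (p + t *: (s *: u))) (s *: u).
have dphiE t : is_derive t (1 : R) phi (dphi t).
  rewrite /dphi dotDl dotNl; apply: is_deriveB; apply: is_derive_line.
    by have [] := tf.
  by have [] := tf.
have cphi : {within `[0, 1]%classic, continuous phi}.
  apply: continuous_subspaceT => t; apply: differentiable_continuous.
  by apply/derivable1_diffP; exact: ex_derive.
have [t t01] := MVT ltr01 (fun t _ => dphiE t) cphi.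
rewrite /phi !scale1r !scale0r !addr0 subr0 mulr1 => ->.
have [t0 t1] : 0 <= t /\ t <= 1.
  by move: t01; rewrite in_itv/= => /andP[/ltW ? /ltW].
have dp x : p + x - p = x by rewrite addrC addKr.
have e1 : p + s *: v + t *: (s *: u) - p = s *: v + t *: (s *: u).
  by rewrite -[p + _ + _]addrA dp.
have -> : dphi t - s ^+ 2 * dot (hess f p *m v) u =
  s * dot (grad f (p + s *: v + t *: (s *: u)) - grad f p
       - hess f p *m (p + s *: v + t *: (s *: u) - p)
    - (grad f (p + t *: (s *: u)) - grad f p
       - hess f p *m (p + t *: (s *: u) - p))) u.
  rewrite /dphi e1 dp mulmxDr -!scalemxAr !dotE.
  by ring.
rewrite normrM gtr0_norm// exprSr -!mulrA mulrCA.
rewrite [leRHS](_ : _ = s * ((2 * L * (s * (enorm u + enorm v)) ^+ 2) * enorm u)); last by ring.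
rewrite ler_wpM2l ?(ltW s0)//; apply: le_trans (dot_abs _ _) _.
rewrite ler_wpM2r//; apply: le_trans (enormB _ _) _.
have tsu : enorm (t *: (s *: u)) <= s * enorm u.
  by rewrite !enormZ ger0_norm// gtr0_norm// ler_piMl ?mulr_ge0 ?(ltW s0).
have sv : enorm (s *: v) = s * enorm v by rewrite enormZ gtr0_norm.
have Q := hess_lipschitz_quadratic p _ tf lf L0.
have B (x : 'cV[R]_d) : enorm x <= s * (enorm u + enorm v) ->
    L * enorm x ^+ 2 <= L * (s * (enorm u + enorm v)) ^+ 2.
  move=> xs; rewrite ler_wpM2l// lerXn2r ?nnegrE ?mulr_ge0 ?addr_ge0 ?(ltW s0)//.
have [snu snv] : 0 <= s * enorm u /\ 0 <= s * enorm v by rewrite !mulr_ge0 ?(ltW s0).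
apply: le_trans (lerD (Q _) (Q _)) _.
rewrite e1 dp.
have := B (s *: v + t *: (s *: u)); have := B (t *: (s *: u)).
have := enormD (s *: v) (t *: (s *: u)).
move=> h1 h2 h3; have := h2 _; have := h3 _; lra.
Qed.

(** Schwarz's theorem: the second difference is symmetric in [u] and [v], so the
two values of the Hessian form differ by [O(s)] for every [s]. *)
Lemma hess_sym L f p : twice_differentiable f -> hess_lipschitz L f -> 0 <= L ->
  forall u v, dot (hess f p *m v) u = dot (hess f p *m u) v.
Proof.
move=> tf lf L0; suff le u v : dot (hess f p *m v) u <= dot (hess f p *m u) v.
  by move=> u v; apply/eqP; rewrite eq_le !le.
pose c (x y : 'cV[R]_d) := 2 * L * (enorm x + enorm y) ^+ 2 * enorm x.
apply: (@le_of_le_small _ _ (c u v + c v u)) => s s0 s1.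
have h1 := second_difference p u v tf lf L0 s0 s1.
have h2 := second_difference p v u tf lf L0 s0 s1.
rewrite -(ler_pM2l (exprn_gt0 2 s0)).
rewrite (addrAC p (s *: u)) in h2.
move: h1 h2; rewrite !ler_norml => /andP[h1 h1'] /andP[h2 h2'].
rewrite [leRHS](_ : _ = s ^+ 2 * dot (hess f p *m u) v
  + (s ^+ 3 * c u v + s ^+ 3 * c v u)); last by ring.
rewrite /c; move: h1 h2'.
move: (s ^+ 3 * _) (s ^+ 3 * _) (s ^+ 2 * _) (s ^+ 2 * _) => a b a' b'; lra.
Qed.

(** The difference quotients in the coordinate directions have an error of the order
of the step. *)
Lemma grad_of_quadratic L f p g :
  (forall q, `|f q - f p - dot g (q - p)| <= L * enorm (q - p) ^+ 2) ->
  grad f p = g.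
Proof.
move=> h; apply/colP => i; rewrite mxE; set e := delta_mx i 0.
have ge : g i 0 = dot g e.
  rewrite /dot (bigD1 i)//= big1 => [|j ji].
    by rewrite mxE !eqxx mulr1 addr0.
  by rewrite mxE (negPf ji) mulr0.
apply: cvg_lim => //; apply/cvgrPdist_le => /= eps eps0; rewrite ge.
have M0 : 0 < `|L| * enorm e ^+ 2 + 1 by rewrite ltr_wpDl// mulr_ge0// sqr_ge0.
(* The difference quotient is within [(|L| |e|^2 + 1) |t|] of its limit; the summand
   1 makes the division by this factor legitimate when [e] or [L] is 0. *)
near=> t.
have tn0 : t != 0 by near: t; exact: nbhs_dnbhs_neq.
have t0 : 0 < `|t| by rewrite normr_gt0.
rewrite -(ler_pM2l t0) -normrM mulrBr mulVKf// distrC.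
have := h (t *: e + p); rewrite addrK dotZr => /le_trans; apply.
rewrite enormZ exprMn.
have : `|t| * (`|L| * enorm e ^+ 2 + 1) <= eps.
  rewrite -ler_pdivlMr//; near: t; exact: dnbhs0_le (divr_gt0 eps0 M0).
move=> te; apply: le_trans (_ : `|t| * (`|t| * (`|L| * enorm e ^+ 2 + 1)) <= _); last first.
  by rewrite ler_pM2l.
rewrite mulrA -expr2 mulrDr mulr1 ler_wpDr ?sqr_ge0// mulrCA ler_wpM2l ?sqr_ge0//.
by rewrite ler_wpM2r ?sqr_ge0// ler_norm.
Unshelve. all: by end_near. Qed.

End Gradient.
End Calculus.

(** * Finite sums of smooth functions *)

Section FiniteSum.
Variables (R : realType) (d n : nat) (F : 'I_n -> 'cV[R]_d -> R).

Lemma dot_inj (u v : 'cV[R]_d) : (forall w, dot u w = dot v w) -> u = v.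
Proof.
move=> uv; apply/eqP; rewrite -subr_eq0; apply/eqP/enorm_eq0/eqP.
by rewrite -sqrf_eq0 enorm_sqr dotDl dotNl uv subrr.
Qed.

Lemma avgE : avg F = n%:R^-1 *: \sum_i F i.
Proof. by apply/funext => p; rewrite /avg [RHS]/GRing.scale /= fct_sumE. Qed.

Lemma differentiable_avg p : (forall i, differentiable (F i) p) ->
  differentiable (avg F) p.
Proof. by move=> dF; rewrite avgE; apply/differentiableZ/differentiable_sum. Qed.

Lemma derive_avg p v : (forall i, derivable (F i) p v) ->
  'D_v (avg F) p = mean (fun i => 'D_v (F i) p).
Proof.
move=> dF; rewrite avgE deriveZ ?derive_sum//; last exact: derivable_sum.
by rewrite /mean card_ord.
Qed.

Lemma grad_avg p : (forall i, differentiable (F i) p) ->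
  grad (avg F) p = vmean (fun i => grad (F i) p).
Proof.
move=> dF; apply/colP => i; rewrite /vmean !mxE summxE derive_avg => [|l].
  by congr (_ * _); apply: eq_bigr => l _; rewrite mxE.
exact: diff_derivable.
Qed.

End FiniteSum.

Section FiniteSumHessian.
Variables (R : realType) (d n : nat) (G : 'I_n -> 'cV[R]_d -> R).
Hypothesis dG : forall j, twice_differentiable (G j).

Let grad_avgE w : (fun q => dot (grad (avg G) q) w) =
  avg (fun j q => dot (grad (G j) q) w).
Proof.
apply/funext => q; rewrite grad_avg => [|i]; last by have [] := dG i.
by rewrite dot_vmean /mean card_ord.
Qed.

Lemma twice_differentiable_avg : twice_differentiable (avg G).
Proof.
split=> p; first by apply: differentiable_avg => j; have [] := dG j.
rewrite [grad _](_ : _ = n%:R^-1 *: \sum_j grad (G j)).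
  by apply/differentiableZ/differentiable_sum => j; have [] := dG j.
apply/funext => q; rewrite grad_avg => [|j]; last by have [] := dG j.
by rewrite /vmean card_ord [RHS]/GRing.scale/= fct_sumE.
Qed.

Lemma hess_avg p v : hess (avg G) p *m v = vmean (fun j => hess (G j) p *m v).
Proof.
apply: dot_inj => w; rewrite dot_vmean.
have [_ dg] := twice_differentiable_avg.
rewrite -[LHS](hessE v w (dg p)).2 grad_avgE derive_avg => [|j].
  by apply: eq_mean => j; have [_ dgj] := dG j; have [_ ->] := hessE v w (dgj p).
have [_ dgj] := dG j; have [dd _] := hessE v w (dgj p); exact: diff_derivable.
Qed.

End FiniteSumHessian.

(** * The bilevel problem and its hypergradient *)

(** The gradient in [(x, y)] of the Lagrangian [f(x, y) - <z, grad_2 g(x, y)>].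
Its two blocks are, up to sign, the mean directions of [x] and of [z]. *)
Definition lagrangian_grad (R : realType) (dx dy : nat)
    (f g : 'cV[R]_(dx + dy) -> R) (p : 'cV[R]_(dx + dy)) (z : 'cV[R]_dy) :=
  grad f p - hess g p *m col_mx 0 z.

Section Blocks.
Variables (R : realType) (dx dy : nat).
Implicit Types (h : 'cV[R]_(dx + dy) -> R) (p u : 'cV[R]_(dx + dy)) (z w : 'cV[R]_dy).

Lemma dot_dsubmx u w : dot (dsubmx u) w = dot u (col_mx 0 w).
Proof. by rewrite -[in RHS](vsubmxK u) dot_col_mx dot0r add0r. Qed.

Lemma hess12E h p z : hess12 h p *m z = usubmx (hess h p *m col_mx (0 : 'cV_dx) z).
Proof.
by rewrite -[in RHS](submxK (hess h p)) mul_block_col col_mxKu mulmx0 add0r.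
Qed.

Lemma hess22E h p z : hess22 h p *m z = dsubmx (hess h p *m col_mx (0 : 'cV_dx) z).
Proof.
by rewrite -[in RHS](submxK (hess h p)) mul_block_col col_mxKd mulmx0 add0r.
Qed.

Lemma col_mx_addZ (x : 'cV[R]_dx) (y : 'cV[R]_dy) t w :
  col_mx x (y + t *: w) = col_mx x y + t *: col_mx 0 w.
Proof. by rewrite scale_col_mx add_col_mx scaler0 addr0. Qed.

End Blocks.

Record smooth_bilevel (R : realType) (dx dy : nat) (f g : 'cV[R]_(dx + dy) -> R)
    (ystar : 'cV[R]_dx -> 'cV[R]_dy) (Lf Cf L1 L2 mu : R) : Prop := SmoothBilevel {
  sb_Lf : 0 <= Lf; sb_Cf : 0 < Cf; sb_L1 : 0 <= L1; sb_L2 : 0 <= L2; sb_mu : 0 < mu;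
  sb_df : forall p, differentiable f p;
  sb_dg : twice_differentiable g;
  sb_ystar : forall x, is_argmin (fun y => g (col_mx x y)) (ystar x);
  sb_lf : grad_lipschitz Lf f;
  sb_bf : forall x, enorm (grad2 f (col_mx x (ystar x))) <= Cf;
  sb_lg : grad_lipschitz L1 g;
  sb_hg : hess_lipschitz L2 g;
  sb_scg : forall x, strongly_convex mu (fun y => g (col_mx x y)) }.

Section Bilevel.
Variables (R : realType) (dx dy : nat) (f g : 'cV[R]_(dx + dy) -> R).
Variables (ystar : 'cV[R]_dx -> 'cV[R]_dy) (Lf Cf L1 L2 mu : R).
Hypothesis B : smooth_bilevel f g ystar Lf Cf L1 L2 mu.

Let Lf0 : 0 <= Lf := sb_Lf B.
Let Cf0 : 0 < Cf := sb_Cf B.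
Let L10 : 0 <= L1 := sb_L1 B.
Let L20 : 0 <= L2 := sb_L2 B.
Let mu0 : 0 < mu := sb_mu B.
Let df := sb_df B.
Let dg := sb_dg B.
Let dg1 p : differentiable g p. Proof. by case: dg. Qed.
Let ystarP := sb_ystar B.
Let lf := sb_lf B.
Let bf := sb_bf B.
Let lg := sb_lg B.
Let hg := sb_hg B.
Let scg := sb_scg B.

(** Strong convexity between [v] and [v + t (u - v)], divided by [t]; the
second-order terms vanish as [t -> 0]. *)
Lemma strongly_convex_first_order x u v :
  g (col_mx x v) + dot (grad2 g (col_mx x v)) (u - v)
    + mu / 2 * enorm (u - v) ^+ 2 <= g (col_mx x u).
Proof.
set D := enorm (u - v) ^+ 2; pose X := dot (grad2 g (col_mx x v)) (u - v).
suff : X <= g (col_mx x u) - g (col_mx x v) - mu / 2 * D by rewrite /X; lra.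
apply: (@le_of_le_small _ _ _ ((L1 + mu / 2) * D)) => t t0 t1.
have := scg x u v (ltW t0) t1.
have -> : t *: u + (1 - t) *: v = v + t *: (u - v).
  by rewrite scalerBl scale1r scalerBr addrCA addrC -addrA addrC.
have := grad_lipschitz_quadratic (col_mx x v) (col_mx x (v + t *: (u - v))) dg1 lg L10.
rewrite col_mx_addZ [_ + _ - col_mx x v]addrC addKr enormZ enorm_col_0mx dotZr.
rewrite -dot_dsubmx -/(grad2 g _) -/X exprMn real_normK ?num_real// -/D.
rewrite ler_norml => /andP[h1 _] h2.
by rewrite -(ler_pM2l t0); nra.
Qed.

Lemma grad2_monotone x u v :
  mu * enorm (u - v) ^+ 2 <=
  dot (grad2 g (col_mx x u) - grad2 g (col_mx x v)) (u - v).
Proof.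
have := strongly_convex_first_order x u v.
have := strongly_convex_first_order x v u.
by rewrite (enormC v u) dotDl dotNl -(opprB u v) dotNr; lra.
Qed.

(** A gradient step of length [t] changes [g] by [- t |w|^2 + O(t^2)], which
minimality forbids unless [w = 0]. *)
Lemma grad2_ystar x : grad2 g (col_mx x (ystar x)) = 0.
Proof.
set p := col_mx x (ystar x); set w := grad2 g p.
apply: enorm_eq0; apply/eqP; rewrite -sqrf_eq0; apply/eqP/le_anti.
rewrite sqr_ge0 andbT; apply: (@le_of_le_small _ _ _ (L1 * enorm w ^+ 2)) => t t0 t1.
have := ystarP x (ystar x + (- t) *: w).
have := grad_lipschitz_quadratic p (col_mx x (ystar x + (- t) *: w)) dg1 lg L10.
rewrite col_mx_addZ -/p [_ + _ - p]addrC addKr enormZ enorm_col_0mx dotZr.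
rewrite -dot_dsubmx -/(grad2 g _) -/w exprMn real_normK ?num_real// -enorm_sqr.
rewrite ler_norml => /andP[_ h1] h2.
by rewrite -(ler_pM2l t0); nra.
Qed.

(** Strong monotonicity of the gradient, differentiated along a segment. *)
Lemma hess22_coercive x y w :
  mu * enorm w ^+ 2 <= dot (hess22 g (col_mx x y) *m w) w.
Proof.
apply: (@le_of_le_small _ _ _ (L2 * enorm w ^+ 2 * enorm w)) => t t0 t1.
have := hess_lipschitz_quadratic (col_mx x y) (col_mx x (y + t *: w)) dg hg L20.
have := grad2_monotone x (y + t *: w) y.
rewrite [y + _ - y]addrC addKr dotZr enormZ.
rewrite col_mx_addZ [_ + _ - col_mx x y]addrC addKr enormZ enorm_col_0mx.
set gd := grad g (col_mx x y + _) - _.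
have -> : grad2 g (col_mx x y + t *: col_mx 0 w) - grad2 g (col_mx x y) = dsubmx gd.
  by rewrite /gd dsubmxB.
rewrite -scalemxAr gtr0_norm// => h1.
set r := gd - _ => h2.
have h3 := dot_le (dsubmx r) w.
have h4 : enorm (dsubmx r) * enorm w <= L2 * (t * enorm w) ^+ 2 * enorm w.
  by rewrite ler_wpM2r// (le_trans (enorm_dsubmx _)).
have e : dot (dsubmx gd) w =
    dot (dsubmx r) w + t * dot (hess22 g (col_mx x y) *m w) w.
  have -> : dsubmx r = dsubmx gd - t *: (hess22 g (col_mx x y) *m w).
    by rewrite hess22E /r dsubmxB; congr (_ - _); rewrite linearZ.
  by rewrite dotDl dotNl dotZl subrK.
rewrite -(ler_pM2l (exprn_gt0 2 t0)); nra.
Qed.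

Lemma hess22_bound x y w :
  mu * enorm w <= enorm (hess22 g (col_mx x y) *m w).
Proof.
have [w0|w0] := eqVneq (enorm w) 0; first by rewrite w0 mulr0.
have wp : 0 < enorm w by rewrite lt_neqAle eq_sym w0 /=.
rewrite -(ler_pM2r wp) -mulrA -expr2; apply: le_trans (hess22_coercive x y w) _.
exact: dot_le.
Qed.

Lemma hess22_unit x y : hess22 g (col_mx x y) \in unitmx.
Proof.
rewrite -unitmx_tr -row_free_unit -kermx_eq0; apply/rowV0P => v /sub_kermxP vA.
apply/trmx_inj; rewrite trmx0; apply: enorm_eq0; apply/le_anti.
rewrite enorm_ge0 andbT -(ler_pM2l mu0) mulr0.
apply: le_trans (hess22_bound x y v^T) _.
by rewrite -[hess22 _ _]trmxK -trmx_mul vA trmx0 enorm0.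
Qed.


(** ** Lipschitz constants of the solution maps and of the hypergradient *)

Definition zstar x : 'cV[R]_dy :=
  invmx (hess22 g (col_mx x (ystar x))) *m grad2 f (col_mx x (ystar x)).

Definition hypergrad x : 'cV[R]_dx :=
  usubmx (lagrangian_grad f g (col_mx x (ystar x)) (zstar x)).

(** [lipy], [lipz] and [lipH] are Lipschitz constants in [x] of [(x, ystar x)], of
[zstar] and of the hypergradient, [bndz] bounds [zstar], and [lipL] is the
Lipschitz constant in [(x, y)] of the Lagrangian gradient at the multiplier
[zstar]. *)
Definition lipy := 1 + L1 / mu.
Definition bndz := Cf / mu.
Definition lipL := Lf + L2 * bndz.
Definition lipz := lipL * lipy / mu.
Definition lipH := lipL * lipy + L1 * lipz.

Lemma lipy_ge0 : 0 <= lipy. Proof. by rewrite addr_ge0// divr_ge0// ltW. Qed.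
Lemma bndz_ge0 : 0 <= bndz. Proof. by rewrite divr_ge0// ltW. Qed.
Lemma lipL_ge0 : 0 <= lipL. Proof. by rewrite addr_ge0// mulr_ge0 ?bndz_ge0. Qed.
Lemma lipz_ge0 : 0 <= lipz.
Proof. by rewrite divr_ge0 ?(ltW mu0)// mulr_ge0 ?lipL_ge0 ?lipy_ge0. Qed.
Lemma lipH_ge0 : 0 <= lipH.
Proof. by rewrite addr_ge0// mulr_ge0 ?lipL_ge0 ?lipy_ge0 ?lipz_ge0. Qed.
#[local] Hint Resolve lipy_ge0 bndz_ge0 lipL_ge0 lipz_ge0 lipH_ge0 : core.

Lemma ystar_lipschitz x1 x2 :
  enorm (ystar x1 - ystar x2) <= L1 / mu * enorm (x1 - x2).
Proof.
set e := ystar x1 - ystar x2.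
have [e0|e0] := eqVneq (enorm e) 0; first by rewrite e0 mulr_ge0// divr_ge0// ltW.
have ep : 0 < enorm e by rewrite lt_neqAle eq_sym e0 /=.
rewrite mulrAC ler_pdivlMr// -(ler_pM2r ep).
rewrite [leLHS](_ : _ = mu * enorm e ^+ 2); last by ring.
apply: le_trans (grad2_monotone x1 _ _) _.
rewrite (grad2_ystar x1) -(grad2_ystar x2); apply: le_trans (dot_le _ _) _.
rewrite ler_wpM2r// /grad2 -dsubmxB; apply: le_trans (enorm_dsubmx _) _.
apply: le_trans (lg _ _) _.
by rewrite col_mxB subrr enorm_col_mx0 (enormC x1).
Qed.

Let pstar x := col_mx x (ystar x).

Lemma pstar_lipschitz x1 x2 :
  enorm (pstar x1 - pstar x2) <= lipy * enorm (x1 - x2).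
Proof.
rewrite col_mxB; apply: le_trans (enorm_col_mx_le _ _) _.
by rewrite mulrDl mul1r lerD2l ystar_lipschitz.
Qed.

Lemma hess22_zstar x : hess22 g (pstar x) *m zstar x = grad2 f (pstar x).
Proof. by rewrite /zstar mulmxA mulmxV ?mul1mx// hess22_unit. Qed.

Lemma zstar_bound x : enorm (zstar x) <= bndz.
Proof.
rewrite ler_pdivlMr// mulrC; apply: le_trans (hess22_bound x (ystar x) _) _.
by rewrite [X in enorm X]hess22_zstar; exact: bf.
Qed.

Lemma lagrangian_grad_star x :
  lagrangian_grad f g (pstar x) (zstar x) = col_mx (hypergrad x) 0.
Proof.
have <- : dsubmx (lagrangian_grad f g (pstar x) (zstar x)) = 0.
  by rewrite dsubmxB -hess22E [X in _ - X]hess22_zstar subrr.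
by rewrite vsubmxK.
Qed.

(** The increment of the Hessian multiplies [zstar], which is bounded; the running
[z], which is not, enters only through its distance to [zstar]. *)
Lemma lagrangian_grad_lipschitz p q z x :
  enorm (lagrangian_grad f g p z - lagrangian_grad f g q (zstar x)) <=
  lipL * enorm (p - q) + L1 * enorm (z - zstar x).
Proof.
have -> : lagrangian_grad f g p z - lagrangian_grad f g q (zstar x) =
    (grad f p - grad f q) - (hess g p *m col_mx 0 (z - zstar x)
      + (hess g p - hess g q) *m col_mx 0 (zstar x)).
  have -> : col_mx 0 (z - zstar x) = col_mx 0 z - col_mx (0 : 'cV_dx) (zstar x).
    by rewrite col_mxB subrr.
  rewrite mulmxBr mulmxBl /lagrangian_grad.
  rewrite [X in _ = _ - X]addrA subrK !opprB addrACA [RHS]addrACA.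
  by rewrite [- _ - _]addrC.
apply: le_trans (enormB _ _) _; rewrite mulrDl addrAC -addrA.
apply: lerD; first exact: lf.
apply: le_trans (enormD _ _) _; apply: lerD.
  by apply: le_trans (enorm_hess_le _ _ dg lg hg L20) _; rewrite enorm_col_0mx.
apply: le_trans (enorm_mulmx _ _) _; rewrite enorm_col_0mx mulrAC.
by apply: ler_pM => //; [exact: opnorm_ge0|exact: zstar_bound].
Qed.

(** The [y]-block of the Lagrangian gradient vanishes at both points and is
[hess22 g], bounded below by [mu], as a function of the multiplier. *)
Lemma zstar_lipschitz x1 x2 :
  enorm (zstar x1 - zstar x2) <= lipz * enorm (x1 - x2).
Proof.
rewrite /lipz mulrAC ler_pdivlMr// mulrC.
apply: le_trans (hess22_bound x1 (ystar x1) _) _.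
have -> : hess22 g (col_mx x1 (ystar x1)) *m (zstar x1 - zstar x2) =
    dsubmx (lagrangian_grad f g (pstar x1) (zstar x2)
      - lagrangian_grad f g (pstar x2) (zstar x2)).
  rewrite dsubmxB [X in _ - dsubmx X]lagrangian_grad_star col_mxKd subr0.
  by rewrite dsubmxB -hess22E mulmxBr [X in X - _]hess22_zstar.
apply: le_trans (enorm_dsubmx _) _.
apply: le_trans (lagrangian_grad_lipschitz _ _ _ _) _.
by rewrite subrr enorm0 mulr0 addr0 -mulrA ler_wpM2l// pstar_lipschitz.
Qed.

Lemma hypergrad_lipschitz x1 x2 :
  enorm (hypergrad x1 - hypergrad x2) <= lipH * enorm (x1 - x2).
Proof.
rewrite /hypergrad -usubmxB; apply: le_trans (enorm_usubmx _) _.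
apply: le_trans (lagrangian_grad_lipschitz _ _ _ _) _.
rewrite [leRHS](_ : _ = lipL * (lipy * enorm (x1 - x2))
  + L1 * (lipz * enorm (x1 - x2))); last by rewrite /lipH; ring.
by rewrite lerD// ler_wpM2l ?pstar_lipschitz ?zstar_lipschitz.
Qed.

(** Along [(x, ystar x)] the constraint [grad_2 g = 0] holds. Expanding it to first
order, testing with [zstar] and using the symmetry of the Hessian trades the
increment of [ystar] in the expansion of [f] for an increment of [x], up to a
quadratic error. *)
Lemma upper_value_quadratic x1 x2 :
  `|upper_value f ystar x2 - upper_value f ystar x1
     - dot (hypergrad x1) (x2 - x1)| <= lipL * lipy ^+ 2 * enorm (x2 - x1) ^+ 2.
Proof.
set p := pstar x1; set q := pstar x2; set z := zstar x1.
have hqp : enorm (q - p) ^+ 2 <= lipy ^+ 2 * enorm (x2 - x1) ^+ 2.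
  by rewrite -exprMn lerXn2r ?nnegrE ?mulr_ge0// pstar_lipschitz.
apply: le_trans (_ : lipL * enorm (q - p) ^+ 2 <= _); last first.
  by rewrite -mulrA ler_wpM2l.
pose r := grad g q - grad g p - hess g p *m (q - p).
have zr : dot (grad f p) (q - p) = dot (hypergrad x1) (x2 - x1) - dot (col_mx 0 z) r.
  have -> : grad f p = lagrangian_grad f g p z + hess g p *m col_mx 0 z.
    by rewrite subrK.
  rewrite lagrangian_grad_star dotDl [in q - p]col_mxB dot_col_mx dot0l addr0.
  rewrite (hess_sym p dg hg L20); congr (_ + _).
  rewrite /r dotDr dotNr [dot _ (hess g p *m _)]dotC -[grad g q - _]vsubmxK.
  rewrite dot_col_mx dot0l add0r dsubmxB -/(grad2 g q) -/(grad2 g p).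
  have gq : grad2 g q = 0 := grad2_ystar x2.
  have gp : grad2 g p = 0 := grad2_ystar x1.
  by rewrite gq gp subrr dot0r add0r opprK -col_mxB.
have := grad_lipschitz_quadratic p q df lf Lf0; rewrite zr => h1.
have h2 : `|dot (col_mx 0 z) r| <= bndz * (L2 * enorm (q - p) ^+ 2).
  apply: le_trans (dot_abs _ _) _; rewrite enorm_col_0mx.
  by apply: ler_pM => //; [exact: zstar_bound|exact: hess_lipschitz_quadratic].
move: h1 h2; rewrite /upper_value -/(pstar x1) -/(pstar x2) -/p -/q.
rewrite /lipL !ler_norml => /andP[h1 h1'] /andP[h2 h2'].
by apply/andP; split; nra.
Qed.

Lemma grad_upper_value x : grad (upper_value f ystar) x = hypergrad x.
Proof. by apply: grad_of_quadratic => q; exact: upper_value_quadratic. Qed.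

End Bilevel.

(** * The sampled directions as blocks of stacked estimators *)

Section Blocks.
Variables (R : realType) (dx dy : nat).
Notation triple := (triple R dx dy).
Implicit Types p q : triple.

Definition stack p : 'cV[R]_(dx + dy + dy) := col_mx (pxy p) (pz p).

Lemma pdistE p q : pdist p q = enorm (stack p - stack q).
Proof. by rewrite /pdist /stack col_mxB. Qed.

Lemma pdist_xy p q : enorm (pxy p - pxy q) <= pdist p q.
Proof. by have := enorm_usubmx (stack p - stack q); rewrite pdistE /stack col_mxB col_mxKu. Qed.

Lemma pdist_z p q : enorm (pz p - pz q) <= pdist p q.
Proof. by have := enorm_dsubmx (stack p - stack q); rewrite pdistE /stack col_mxB col_mxKd. Qed.

Lemma pdist_triangle r p q : pdist p q <= pdist p r + pdist r q.
Proof. by rewrite !pdistE enorm_dist. Qed.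

Lemma pdistC p q : pdist p q = pdist q p.
Proof. by rewrite !pdistE enormC. Qed.

Lemma pdist_ge0 p q : 0 <= pdist p q. Proof. exact: enorm_ge0. Qed.

Lemma saga_linear s d e (A : {linear 'cV[R]_d -> 'cV[R]_e})
    (phi : 'I_s -> triple -> 'cV[R]_d) w l p :
  A (saga phi w l p) = saga (fun i p => A (phi i p)) w l p.
Proof. by rewrite /saga linearD linearB linearZ linear_sum. Qed.

End Blocks.

Section Directions.
Variables (R : realType) (dx dy n m : nat).
Variables (F : 'I_n -> 'cV[R]_(dx + dy) -> R) (G : 'I_m -> 'cV[R]_(dx + dy) -> R).
Notation triple := (triple R dx dy).

Definition gradF i (p : triple) := grad (F i) (pxy p).
Definition gradG j (p : triple) := grad (G j) (pxy p).
Definition hessGz j (p : triple) := hess (G j) (pxy p) *m col_mx (0 : 'cV_dx) (pz p).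

(** The sampled directions of [x] and of [- z] are the two blocks of one vector, so
their bias and variance are estimated together. *)
Definition dir_xz (wf : 'I_n -> triple) (wg : 'I_m -> triple) (l : 'I_n * 'I_m) p :=
  saga gradF wf l.1 p - saga hessGz wg l.2 p.

Lemma dir_yE wg j p : dir_y G wg j p = dsubmx (saga gradG wg j p).
Proof. by rewrite (saga_linear (@dsubmx R dx dy 1)). Qed.

Lemma dir_xE wf wg i j p : dir_x F G wf wg i j p = usubmx (dir_xz wf wg (i, j) p).
Proof.
rewrite /dir_x /dir_xz linearB/= !(saga_linear (@usubmx R dx dy 1)); congr (_ - _).
by congr saga; apply/funext => l; apply/funext => q; rewrite hess12E.
Qed.

Lemma dir_zE wf wg i j p : dir_z F G wf wg i j p = - dsubmx (dir_xz wf wg (i, j) p).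
Proof.
rewrite /dir_z /dir_xz linearB/= !(saga_linear (@dsubmx R dx dy 1)) opprB; congr (_ - _).
by congr saga; apply/funext => l; apply/funext => q; rewrite hess22E.
Qed.

End Directions.

(** * Memory error after one step *)

Section Memory.
Variables (R : realType) (dx dy s : nat) (T : finType).
Variables (w : 'I_s -> triple R dx dy) (p : triple R dx dy).
Variables (l : T -> 'I_s) (q : T -> triple R dx dy).
Hypotheses (s0 : (0 < s)%N) (T0 : (0 < #|T|)%N).
Hypothesis uniform_l : forall X : 'I_s -> R, mean (fun t => X (l t)) = mean X.

Definition mem_error (w : 'I_s -> triple R dx dy) p :=
  mean (fun i => pdist p (w i) ^+ 2).

Let Is0 : (0 < #|'I_s|)%N. Proof. by rewrite card_ord. Qed.

Let mem_error_remember t :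
  let e i := stack p - stack (w i) in
  let D := stack (q t) - stack p in
  mem_error (remember w (l t) p) (q t) =
  enorm D ^+ 2 + 2 * dot D (vmean e) + mem_error w p
  - s%:R^-1 * (2 * dot D (e (l t)) + enorm (e (l t)) ^+ 2).
Proof.
move=> e D; pose k := 2 * dot D (e (l t)) + enorm (e (l t)) ^+ 2.
have de i : enorm (D + e i) ^+ 2 = enorm D ^+ 2 + (2 * dot (e i) D + enorm (e i) ^+ 2).
  exact: sqr_enormD.
transitivity (mean (fun i => enorm (D + e i) ^+ 2 + - ((i == l t)%:R * k))).
  apply: eq_mean => i; rewrite pdistE /remember.
  have [->|_] := eqVneq i (l t); last by rewrite mul0r subr0 /D /e addrA subrK.
  by rewrite mul1r de -/D (dotC _ D) -/k addrK.
(* Only the refreshed entry [l t] contributes to the correction. *)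
rewrite meanD meanN; congr (_ - _); last first.
  rewrite /mean (bigD1 (l t))//= eqxx mul1r big1 ?addr0 ?card_ord// => i /negPf ->.
  by rewrite mul0r.
rewrite (eq_mean de) meanD (mean_cst Is0) meanD meanZ -dot_vmean (dotC _ D) -addrA.
by congr (_ + (_ + _)); apply: eq_mean => i; rewrite pdistE.
Qed.

(** A memory is refreshed with probability [1/s], which shrinks the error by
the factor [1 - 1/s]. The displacement of the iterate is split into its mean, which must
be paid with a factor of order [N], and its noise, which is centred and is paid
with a constant factor only. The index that picks the refreshed memory also
drives the displacement; the resulting correlation is the term in [e (l t)]. *)
Lemma mem_error_step (N : R) (D := fun t => stack (q t) - stack p) : s%:R <= N ->
  mean (fun t => mem_error (remember w (l t) p) (q t)) <=
  (1 - (2 * N)^-1) * mem_error w p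
  + 4 * N * enorm (vmean D) ^+ 2 + 5 * mean (fun t => enorm (D t) ^+ 2).
Proof.
move=> sN; pose e i := stack p - stack (w i); move ES : (mem_error w p) => S.
have s1 : 1 <= s%:R :> R by rewrite ler1n.
have N0 : 0 < N by apply: lt_le_trans sN; lra.
have S0 : 0 <= S by rewrite -ES; apply: mean_ge0 => i; rewrite sqr_ge0.
have Se : mean (fun i => enorm (e i) ^+ 2) = S.
  by rewrite -ES; apply: eq_mean => i; rewrite pdistE.
have is0 : 0 < s%:R^-1 :> R by rewrite invr_gt0; lra.
have is1 : s%:R^-1 <= 1 :> R by rewrite invf_le1//; lra.
have step t : mem_error (remember w (l t) p) (q t) <=
    (5 * enorm (D t) ^+ 2 + (2 * dot (D t) (vmean e) + S))
     + (- (3 / 4 * s%:R^-1)) * enorm (e (l t)) ^+ 2.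
  rewrite mem_error_remember -/(D t) -/(e _) ES.
  have h : - (2 * dot (D t) (e (l t))) <=
      4 * enorm (D t) ^+ 2 + 4^-1 * enorm (e (l t)) ^+ 2.
    move: (D t) (e (l t)) => u v; have := dot_ge0 (2 *: u + 2^-1 *: v).
    by rewrite !enorm_sqr !dotE (dotC v u) => h; lra.
  have D0 : 0 <= enorm (D t) ^+ 2 by rewrite sqr_ge0.
  rewrite -/(e (l t)).
  have := ler_wpM2l (ltW is0) h.
  have : s%:R^-1 * enorm (D t) ^+ 2 <= enorm (D t) ^+ 2 by rewrite ler_piMl.
  by rewrite !mulrDr !mulrN; lra.
apply: le_trans (mean_le step) _.
rewrite !meanD !meanZ (uniform_l (fun i => enorm (e i) ^+ 2)) Se.
rewrite (mean_cst T0) -dot_vmean.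
have cross : 2 * dot (vmean D) (vmean e) <=
    4 * N * enorm (vmean D) ^+ 2 + (4 * N)^-1 * S.
  have := sqr_vmean_le Is0 e; rewrite Se => eS.
  have : (4 * N)^-1 * enorm (vmean e) ^+ 2 <= (4 * N)^-1 * S.
    by rewrite ler_wpM2l// invr_ge0 mulr_ge0// ltW.
  rewrite -(lerD2l (4 * N * enorm (vmean D) ^+ 2)) => h0; apply: le_trans h0.
  rewrite -subr_ge0.
  move: (vmean D) (vmean e) => u v; have := dot_ge0 ((4 * N) *: u - v).
  have i4 : 0 < (4 * N)^-1 by rewrite invr_gt0 mulr_gt0.
  rewrite !enorm_sqr !dotE (dotC v u) => /(mulr_ge0 (ltW i4)) h.
  apply: le_trans h _; rewrite le_eqVlt; apply/orP; left; apply/eqP.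
  by field; lra.
have iNs : N^-1 <= s%:R^-1 by rewrite lef_pV2 ?posrE//; lra.
have iN : N^-1 * S <= s%:R^-1 * S by rewrite ler_wpM2r.
rewrite invfM -mulrA in cross; rewrite invfM.
rewrite [X in _ + X](_ : _ = - (3 / 4 * (s%:R^-1 * S))); last by ring.
rewrite [X in _ <= X + _ + _](_ : _ = S - 2^-1 * (N^-1 * S)); last by ring.
lra.
Qed.

End Memory.

(** * Expected progress of one iteration *)

Record finite_sum_bilevel (R : realType) (dx dy n m : nat)
    (F : 'I_n -> 'cV[R]_(dx + dy) -> R) (G : 'I_m -> 'cV[R]_(dx + dy) -> R)
    (ystar : 'cV[R]_dx -> 'cV[R]_dy) (Lf Cf L1 L2 mu : R) : Prop :=
  FiniteSumBilevel {
    fs_n : (0 < n)%N; fs_m : (0 < m)%N;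
    fs_B : smooth_bilevel (avg F) (avg G) ystar Lf Cf L1 L2 mu;
    fs_dF : forall i p, differentiable (F i) p;
    fs_dG : forall j, twice_differentiable (G j);
    fs_lF : forall i, grad_lipschitz Lf (F i);
    fs_lG : forall j, grad_lipschitz L1 (G j);
    fs_hG : forall j, hess_lipschitz L2 (G j) }.

Section VmeanLinear.
Variables (R : realType) (T : finType) (d e : nat).

Lemma vmean_usubmx (U : T -> 'cV[R]_(d + e)) :
  vmean (fun t => usubmx (U t)) = usubmx (vmean U).
Proof.
by apply/colP => i; rewrite /vmean !mxE !summxE; under eq_bigr do rewrite mxE.
Qed.

Lemma vmean_dsubmx (U : T -> 'cV[R]_(d + e)) :
  vmean (fun t => dsubmx (U t)) = dsubmx (vmean U).
Proof.
by apply/colP => i; rewrite /vmean !mxE !summxE; under eq_bigr do rewrite mxE.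
Qed.

Lemma vmean_col_mx (U : T -> 'cV[R]_d) (V : T -> 'cV[R]_e) :
  vmean (fun t => col_mx (U t) (V t)) = col_mx (vmean U) (vmean V).
Proof.
rewrite -[LHS]vsubmxK -vmean_usubmx -vmean_dsubmx.
by congr (col_mx (_ *: _) (_ *: _)); apply: eq_bigr => t _; rewrite ?col_mxKu ?col_mxKd.
Qed.

Lemma vmean_center (T0 : (0 < #|T|)%N) (a : R) (U : T -> 'cV[R]_d) :
  vmean (fun t => a *: (U t - vmean U)) = 0.
Proof. by rewrite vmeanZ vmeanB (vmean_cst T0) subrr scaler0. Qed.

End VmeanLinear.

(** A contraction of the squared distance absorbs a drift [b] of its target at
the price of half of the contraction and of a factor of order [1 / eta]. *)
Lemma contraction_drift (R : realType) d (eta mu A : R) (a b : 'cV[R]_d) :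
  0 < mu -> 0 < eta -> eta <= 1 -> 0 <= A ->
  enorm a ^+ 2 <= (1 - eta * mu) * A ->
  enorm (a + b) ^+ 2 <= (1 - eta * (mu / 2)) * A
    + (1 + 2 / mu) / eta * enorm b ^+ 2.
Proof.
move=> mu0 eta0 eta1 A0 ha; have t0 : 0 < eta * (mu / 2) by rewrite !mulr_gt0.
apply: le_trans (sqr_enormD_young a b t0) _; apply: lerD.
  apply: le_trans (ler_wpM2l _ ha) _; first by rewrite addr_ge0// ltW.
  rewrite -subr_ge0.
  rewrite [X in 0 <= X](_ : _ = 2 * (eta * (mu / 2)) ^+ 2 * A); last by field.
  by rewrite mulr_ge0// mulr_ge0// sqr_ge0.
rewrite ler_wpM2r ?sqr_ge0// ler_pdivlMr// mulrDl mul1r.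
rewrite [X in _ + X](_ : _ = 2 / mu); last by field; rewrite !gt_eqF.
by rewrite lerD2r.
Qed.

(** One iteration with a common step size for [y], [z] and the momentum. *)
Definition pair_step (R : realType) (dx dy n m : nat)
    (F : 'I_n -> 'cV[R]_(dx + dy) -> R) (G : 'I_m -> 'cV[R]_(dx + dy) -> R)
    (alpha eta : R) (s : saba_state R dx dy n m) (l : 'I_n * 'I_m) :=
  saba_step F G alpha eta eta eta l.1 l.2 s.

Section OneStep.
Variables (R : realType) (dx dy n m : nat).
Variables (F : 'I_n -> 'cV[R]_(dx + dy) -> R) (G : 'I_m -> 'cV[R]_(dx + dy) -> R).
Variables (ystar : 'cV[R]_dx -> 'cV[R]_dy) (Lf Cf L1 L2 mu : R).
Hypothesis FB : finite_sum_bilevel F G ystar Lf Cf L1 L2 mu.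

Let f := avg F.
Let g := avg G.
Let B : smooth_bilevel f g ystar Lf Cf L1 L2 mu := fs_B FB.
Let n0 := fs_n FB.
Let m0 := fs_m FB.
Let Lf0 : 0 <= Lf := sb_Lf B.
Let L10 : 0 <= L1 := sb_L1 B.
Let L20 : 0 <= L2 := sb_L2 B.
Let mu0 : 0 < mu := sb_mu B.
Let T := ('I_n * 'I_m)%type.
Let cn0 : (0 < #|'I_n|)%N. Proof. by rewrite card_ord. Qed.
Let cm0 : (0 < #|'I_m|)%N. Proof. by rewrite card_ord. Qed.
Let T0 : (0 < #|{: T}|)%N. Proof. exact: card_pair_gt0. Qed.
Notation triple := (triple R dx dy).
Implicit Types (p : triple) (wf : 'I_n -> triple) (wg : 'I_m -> triple).

Let cB := bndz Cf mu.
Let cL := lipL Lf Cf L2 mu.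
Let cy := lipy L1 mu.
Let cz := lipz Lf Cf L1 L2 mu.
Let cH := lipH Lf Cf L1 L2 mu.
Let cB0 : 0 <= cB := bndz_ge0 B.
Let cL0 : 0 <= cL := lipL_ge0 B.
Let cz0 : 0 <= cz := lipz_ge0 B.
Let cH0 : 0 <= cH := lipH_ge0 B.
Let LL0 : 0 <= L1 + cL. Proof. exact: addr_ge0. Qed.
Let Lmu0 : 0 <= L1 / mu. Proof. by rewrite divr_ge0// ltW. Qed.
Let Gam := hypergrad f g ystar.
Let zs := zstar f g ystar.
Let Phi p := lagrangian_grad f g (pxy p) (pz p).

Definition varL := 4 * (L1 + cL) ^+ 2.

Lemma vmean_gradG p : vmean (fun j => gradG G j p) = grad g (pxy p).
Proof. by rewrite [RHS]grad_avg// => j; have [] := fs_dG FB j. Qed.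

Lemma vmean_sagaG wg p :
  vmean (fun l : T => saga (gradG G) wg l.2 p) = grad g (pxy p).
Proof.
rewrite (vmean_snd cn0 (fun j => saga (gradG G) wg j p)) vmean_saga//.
exact: vmean_gradG.
Qed.

Lemma vmean_dir_xz wf wg p : vmean (fun l : T => dir_xz F G wf wg l p) = Phi p.
Proof.
rewrite /dir_xz vmeanB (vmean_snd cn0 (fun j => saga (hessGz G) wg j p)).
rewrite (vmean_fst cm0 (fun i => saga (gradF F) wf i p)) !vmean_saga//.
congr (_ - _); first by rewrite [RHS]grad_avg// => i; exact: (fs_dF FB).
by rewrite hess_avg//; exact: (fs_dG FB).
Qed.

Lemma variance_sagaG wg p :
  mean (fun l : T => enorm (saga (gradG G) wg l.2 p - grad g (pxy p)) ^+ 2)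
  <= L1 ^+ 2 * mem_error wg p.
Proof.
rewrite (mean_snd cn0 (fun j => enorm (saga (gradG G) wg j p - grad g (pxy p)) ^+ 2)).
rewrite -vmean_gradG; apply: le_trans (variance_saga _ _ _ m0) _.
rewrite /mem_error -meanZ; apply: mean_le => j.
rewrite -exprMn lerXn2r ?nnegrE ?mulr_ge0 ?pdist_ge0//.
apply: le_trans (fs_lG FB j _ _) _.
by rewrite ler_wpM2l// pdist_xy.
Qed.

(** The maps [hess G_j (x, y) z] are not Lipschitz, since [z] is unbounded.
Splitting [z] into the bounded [zstar] and the error [z - zstar] leaves a
Lipschitz part and a part of the size of the error: the Hessians themselves are
bounded. *)
Lemma hessGz_lipschitz j p q x :
  enorm (hessGz G j p - hessGz G j q) <=
  (L1 + L2 * cB) * pdist p q + 2 * L1 * enorm (pz p - zs x).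
Proof.
have hb := enorm_hess_le _ _ (fs_dG FB j) (fs_lG FB j) (fs_hG FB j) L20.
set a := hess (G j) (pxy p); set b := hess (G j) (pxy q).
have cmB (u v : 'cV[R]_dy) :
    col_mx 0 (u - v) = col_mx 0 u - col_mx (0 : 'cV_dx) v.
  by rewrite col_mxB subrr.
have splitE d e (M N : 'M[R]_(d, e)) (u v w : 'cV_e) : M *m u - N *m v =
    N *m (u - v) + (M - N) *m w + (M *m (u - w) - N *m (u - w)).
  rewrite !mulmxBr mulmxBl.
  by apply/colP => i; rewrite !mxE; ring.
have -> : hessGz G j p - hessGz G j q =
    b *m col_mx 0 (pz p - pz q) + (a - b) *m col_mx 0 (zs x)
    + (a *m col_mx 0 (pz p - zs x) - b *m col_mx 0 (pz p - zs x)).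
  by rewrite !cmB; exact: splitE.
rewrite mulrDl (_ : 2 * L1 * enorm _ = L1 * enorm (pz p - zs x)
  + L1 * enorm (pz p - zs x)); last by ring.
apply: le_trans (enormD _ _) _; apply: lerD.
  apply: le_trans (enormD _ _) _; apply: lerD.
    apply: le_trans (hb _ _) _; rewrite enorm_col_0mx ler_wpM2l//.
    exact: pdist_z.
  apply: le_trans (enorm_mulmx _ _) _; rewrite enorm_col_0mx mulrAC.
  apply: ler_pM => //; [exact: opnorm_ge0| |exact: (zstar_bound B)].
  apply: le_trans (fs_hG FB j _ _) _.
  by rewrite ler_wpM2l// pdist_xy.
apply: le_trans (enormB _ _) _; rewrite -(enorm_col_0mx dx (pz p - zs x)).
by apply: lerD; exact: hb.
Qed.

(** The factors come from applying [(a + b)^2 <= 2 a^2 + 2 b^2] once to the two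
estimators and once to the two parts in [hessGz_lipschitz]. *)
Lemma variance_dir_xz wf wg p x :
  mean (fun l : T => enorm (dir_xz F G wf wg l p - Phi p) ^+ 2) <=
  varL * (mem_error wf p + mem_error wg p)
  + 16 * L1 ^+ 2 * enorm (pz p - zs x) ^+ 2.
Proof.
pose af i := saga (gradF F) wf i p - vmean (gradF F ^~ p).
pose ag j := saga (hessGz G) wg j p - vmean (hessGz G ^~ p).
have split l : enorm (dir_xz F G wf wg l p - Phi p) ^+ 2 <=
    2 * enorm (af l.1) ^+ 2 + 2 * enorm (ag l.2) ^+ 2.
  have -> : dir_xz F G wf wg l p - Phi p = af l.1 + - ag l.2.
    rewrite -(vmean_dir_xz wf wg) /dir_xz vmeanB.
    rewrite (vmean_snd cn0 (fun j => saga (hessGz G) wg j p)).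
    rewrite (vmean_fst cm0 (fun i => saga (gradF F) wf i p)) !vmean_saga//.
    rewrite /af /ag !opprB addrACA [RHS]addrACA; congr (_ + _).
    by rewrite addrC.
  by rewrite -(enormN (ag _)) sqr_enormD2.
apply: le_trans (mean_le split) _; rewrite meanD !meanZ.
rewrite (mean_fst cm0 (fun i => enorm (af i) ^+ 2)).
rewrite (mean_snd cn0 (fun i => enorm (ag i) ^+ 2)).
have hf : mean (fun i => enorm (af i) ^+ 2) <= (L1 + cL) ^+ 2 * mem_error wf p.
  apply: le_trans (variance_saga _ _ _ n0) _.
  rewrite /mem_error -meanZ; apply: mean_le => i.
  rewrite -exprMn lerXn2r ?nnegrE ?mulr_ge0 ?LL0 ?pdist_ge0//.
  apply: le_trans (fs_lF FB i _ _) _.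
  apply: ler_pM; rewrite ?pdist_xy//.
  by rewrite /cL /lipL addrCA lerDl; apply: addr_ge0 => //; exact: mulr_ge0.
have hg : mean (fun j => enorm (ag j) ^+ 2) <=
    2 * (L1 + cL) ^+ 2 * mem_error wg p + 8 * L1 ^+ 2 * enorm (pz p - zs x) ^+ 2.
  apply: le_trans (variance_saga _ _ _ m0) _.
  rewrite -[X in _ + X](mean_cst cm0) /mem_error -meanZ -meanD.
  apply: mean_le => j; have h := hessGz_lipschitz j p (wg j) x.
  have h2 : (L1 + L2 * cB) * pdist p (wg j) <= (L1 + cL) * pdist p (wg j).
      by rewrite ler_wpM2r ?pdist_ge0// lerD2l lerDr.
  have h3 := le_trans h (lerD h2 (lexx _)).
  apply: le_trans (_ : ((L1 + cL) * pdist p (wg j) + 2 * L1 * enorm (pz p - zs x)) ^+ 2 <= _).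
    rewrite lerXn2r ?nnegrE// addr_ge0//; apply: mulr_ge0 => //.
    + exact: pdist_ge0.
    + exact: mulr_ge0.
  have := sqr_ge0 ((L1 + cL) * pdist p (wg j) - 2 * L1 * enorm (pz p - zs x)).
  move: (pdist _ _) (enorm _) => a b; lra.
have SF0 : 0 <= mem_error wf p by apply: mean_ge0 => i; rewrite sqr_ge0.
have := mulr_ge0 (sqr_ge0 (L1 + cL)) SF0.
rewrite /varL; lra.
Qed.


Section Step.
Variables (s : saba_state R dx dy n m) (alpha eta : R).
Hypotheses (alpha0 : 0 < alpha) (eta0 : 0 < eta) (eta1 : eta <= 1).

Let p := cur s.
Let x := px p.
Let step := pair_step F G alpha eta s.
Let X l := dir_xz F G (memf s) (memg s) l p.
Let U (l : T) := saga (gradG G) (memg s) l.2 p.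
Let vX : vmean X = Phi p. Proof. exact: vmean_dir_xz. Qed.
Let vU : vmean U = grad g (pxy p). Proof. exact: vmean_sagaG. Qed.

Definition err_y (s : saba_state R dx dy n m) := enorm (py (cur s) - ystar (px (cur s))) ^+ 2.
Definition err_z (s : saba_state R dx dy n m) := enorm (pz (cur s) - zs (px (cur s))) ^+ 2.
Definition err_v (s : saba_state R dx dy n m) := enorm (vx s - Gam (px (cur s))) ^+ 2.
Definition err_w (s : saba_state R dx dy n m) :=
  mem_error (memf s) (cur s) + mem_error (memg s) (cur s).
Definition sqr_v (s : saba_state R dx dy n m) := enorm (vx s) ^+ 2.

Lemma err_w_ge0 s' : 0 <= err_w s'.
Proof. by apply: addr_ge0; apply: mean_ge0 => i; rewrite sqr_ge0. Qed.

Let vx_step l : vx (step l) = (1 - eta) *: vx s + eta *: usubmx (X l).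
Proof. by case: l => i j; rewrite -dir_xE. Qed.

Let py_step l : py (cur (step l)) = py p - eta *: dsubmx (U l).
Proof. by case: l => i j; rewrite -dir_yE. Qed.

Let pz_step l : pz (cur (step l)) = pz p + eta *: dsubmx (X l).
Proof. by case: l => i j; rewrite -[dsubmx _]opprK -dir_zE scalerN. Qed.

Let px_step l : px (cur (step l)) = x - alpha *: vx s. Proof. by []. Qed.

Let drift_x l : enorm (x - px (cur (step l))) ^+ 2 = alpha ^+ 2 * sqr_v s.
Proof.
by rewrite px_step opprB addrC subrK sqr_enormZ.
Qed.

Let distXstar : enorm (pxy p - col_mx x (ystar x)) ^+ 2 = err_y s.
Proof. by rewrite /pxy col_mxB subrr enorm_col_0mx. Qed.

Let noise_y : mean (fun l => enorm (dsubmx (U l) - vmean (fun l => dsubmx (U l))) ^+ 2)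
  <= L1 ^+ 2 * err_w s.
Proof.
apply: le_trans (_ : mean (fun l => enorm (U l - vmean U) ^+ 2) <= _).
  apply: mean_le => l; rewrite vmean_dsubmx -dsubmxB.
  by rewrite lerXn2r ?nnegrE// enorm_dsubmx.
rewrite vU; apply: le_trans (variance_sagaG _ _) _.
rewrite ler_wpM2l ?sqr_ge0// lerDr; apply: mean_ge0 => i; exact: sqr_ge0.
Qed.

Let noise_X : mean (fun l => enorm (X l - vmean X) ^+ 2)
  <= varL * err_w s + 16 * L1 ^+ 2 * err_z s.
Proof. by rewrite vX; exact: variance_dir_xz. Qed.

Let noise_z : mean (fun l => enorm (dsubmx (X l) - vmean (fun l => dsubmx (X l))) ^+ 2)
  <= varL * err_w s + 16 * L1 ^+ 2 * err_z s.
Proof.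
apply: le_trans noise_X; apply: mean_le => l; rewrite vmean_dsubmx -dsubmxB.
by rewrite lerXn2r ?nnegrE// enorm_dsubmx.
Qed.

Let noise_x : mean (fun l => enorm (usubmx (X l) - vmean (fun l => usubmx (X l))) ^+ 2)
  <= varL * err_w s + 16 * L1 ^+ 2 * err_z s.
Proof.
apply: le_trans noise_X; apply: mean_le => l; rewrite vmean_usubmx -usubmxB.
by rewrite lerXn2r ?nnegrE// enorm_usubmx.
Qed.

(** The descent lemma along [- v], with the polarisation identity for
[<Gam x, v>]. *)
Lemma descent_step l :
  upper_value f ystar (px (cur (step l))) <= upper_value f ystar x
    - alpha / 2 * enorm (Gam x) ^+ 2 - alpha / 2 * sqr_v s + alpha / 2 * err_v s
    + cL * cy ^+ 2 * (alpha ^+ 2 * sqr_v s).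
Proof.
have := upper_value_quadratic B x (px (cur (step l))).
rewrite -/cL -/cy -/Gam (enormC _ x) drift_x ler_norml => /andP[_].
rewrite px_step [x - _ - x]addrC addKr dotNr dotZr.
have : err_v s = sqr_v s + (2 * dot (- Gam x) (vx s) + enorm (Gam x) ^+ 2).
  by rewrite /err_v sqr_enormD enormN.
by rewrite dotNl => -> h; lra.
Qed.

Let bias_X : enorm (Phi p - col_mx (Gam x) 0) ^+ 2
  <= 2 * cL ^+ 2 * err_y s + 2 * L1 ^+ 2 * err_z s.
Proof.
rewrite -(lagrangian_grad_star B).
have h := lagrangian_grad_lipschitz B (pxy p) (col_mx x (ystar x)) (pz p) x.
have := sqr_ge0 (cL * enorm (pxy p - col_mx x (ystar x)) - L1 * enorm (pz p - zs x)).
rewrite -distXstar /err_z -/p -/x => h2.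
apply: le_trans (_ : (cL * enorm (pxy p - col_mx x (ystar x))
    + L1 * enorm (pz p - zs x)) ^+ 2 <= _).
  by rewrite lerXn2r ?nnegrE// addr_ge0// mulr_ge0.
move: h2; move: (enorm _) (enorm _) => a b; lra.
Qed.

(** The new velocity error is the convex combination, with weights [1 - eta] and
[eta], of the old one and of the bias plus the drift of the hypergradient divided
by [eta], plus centred noise. *)
Lemma err_v_step :
  mean (fun l => err_v (step l)) <= (1 - eta) * err_v s
    + 2 * cH ^+ 2 * (alpha ^+ 2 / eta * sqr_v s)
    + eta * (4 * cL ^+ 2 * err_y s + 4 * L1 ^+ 2 * err_z s)
    + eta ^+ 2 * (varL * err_w s + 16 * L1 ^+ 2 * err_z s).
Proof.
pose l0 : T := (Ordinal n0, Ordinal m0).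
pose b := usubmx (Phi p) - Gam x; pose c := Gam x - Gam (px (cur (step l0))).
pose e := (1 - eta) *: (vx s - Gam x) + (eta *: b + c).
have eE l : err_v (step l) =
    enorm (e + eta *: (usubmx (X l) - vmean (fun l => usubmx (X l)))) ^+ 2.
  rewrite /err_v vx_step vmean_usubmx vX (_ : px _ = px (cur (step l0)))//.
  congr (enorm _ ^+ 2); rewrite /e /b /c.
  move: (usubmx (X l)) (usubmx (Phi p)) (Gam x) (Gam _) => v1 v2 v3 v4.
  by apply/colP => i; rewrite !mxE; ring.
rewrite (eq_mean eE) (mean_sqr_center T0); apply: lerD; last first.
  by rewrite ler_wpM2l ?sqr_ge0.
apply: (le_trans (sqr_enorm_convex (vx s - Gam x) (eta *: b + c) eta0 eta1)).
have -> : enorm (vx s - Gam x) ^+ 2 = err_v s by [].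
rewrite -addrA lerD2l.
have hb : enorm b ^+ 2 <= 2 * cL ^+ 2 * err_y s + 2 * L1 ^+ 2 * err_z s.
  apply: le_trans bias_X; rewrite lerXn2r ?nnegrE//.
  have -> : b = usubmx (Phi p - col_mx (Gam x) 0) by rewrite usubmxB col_mxKu.
  exact: enorm_usubmx.
have hc : enorm c ^+ 2 <= cH ^+ 2 * (alpha ^+ 2 * sqr_v s).
  rewrite -(drift_x l0) -exprMn lerXn2r ?nnegrE ?mulr_ge0//.
  exact: (hypergrad_lipschitz B).
have h := sqr_enormZD2 eta b c.
rewrite mulrC ler_pdivrMr//; apply: le_trans h _.
have h2 := ler_wpM2l (sqr_ge0 eta) hb.
rewrite [leRHS](_ : _ = 2 * (eta ^+ 2 * (2 * cL ^+ 2 * err_y s + 2 * L1 ^+ 2 * err_z s))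
  + 2 * (cH ^+ 2 * (alpha ^+ 2 * sqr_v s))); last by field; rewrite gt_eqF.
by apply: lerD; rewrite ler_pM2l.
Qed.

Let sqr_grad2_le : enorm (grad2 g (pxy p)) ^+ 2 <= L1 ^+ 2 * err_y s.
Proof.
rewrite -exprMn lerXn2r ?nnegrE ?mulr_ge0//.
rewrite -[grad2 _ _]subr0 -(grad2_ystar B x) /grad2 -dsubmxB.
apply: le_trans (enorm_dsubmx _) _; apply: le_trans (sb_lg B _ _) _.
by rewrite /pxy col_mxB subrr enorm_col_0mx.
Qed.

(** Strong monotonicity makes the mean step of [y] a contraction towards [ystar x];
the target then moves with [x]. *)
Lemma err_y_step : eta * L1 ^+ 2 <= mu ->
  mean (fun l => err_y (step l)) <= (1 - eta * (mu / 2)) * err_y s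
    + (1 + 2 / mu) * (L1 / mu) ^+ 2 * (alpha ^+ 2 / eta * sqr_v s)
    + eta ^+ 2 * (L1 ^+ 2 * err_w s).
Proof.
move=> etaL; pose l0 : T := (Ordinal n0, Ordinal m0).
pose gy := grad2 g (pxy p); pose b := ystar x - ystar (px (cur (step l0))).
pose e := (py p - ystar x - eta *: gy) + b.
have eE l : err_y (step l) =
    enorm (e + - eta *: (dsubmx (U l) - vmean (fun l => dsubmx (U l)))) ^+ 2.
  rewrite /err_y py_step vmean_dsubmx vU (_ : px _ = px (cur (step l0)))//.
  congr (enorm _ ^+ 2); rewrite /e /b /gy /grad2.
  move: (dsubmx (U l)) (dsubmx _) (ystar x) (ystar _) => v1 v2 v3 v4.
  by apply/colP => i; rewrite !mxE; ring.
rewrite (eq_mean eE) (mean_sqr_center T0) sqrrN; apply: lerD; last first.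
  by rewrite ler_wpM2l ?sqr_ge0.
have ha : enorm (py p - ystar x - eta *: gy) ^+ 2 <= (1 - eta * mu) * err_y s.
  have h1 : mu * err_y s <= dot gy (py p - ystar x).
    by have := grad2_monotone B x (py p) (ystar x); rewrite (grad2_ystar B) subr0.
  have h2 : enorm gy ^+ 2 <= L1 ^+ 2 * err_y s := sqr_grad2_le.
  rewrite sqr_enorm_subZ.
  have h3 := ler_wpM2l (sqr_ge0 eta) h2.
  have h4 := ler_wpM2l (ltW eta0) h1.
  have h5 : eta * (eta * L1 ^+ 2 * err_y s) <= eta * (mu * err_y s).
    by rewrite ler_wpM2l ?(ltW eta0)// ler_wpM2r// sqr_ge0.
  have -> : enorm (py p - ystar x) ^+ 2 = err_y s by [].
  by move: (err_y s) (dot _ _) (enorm gy ^+ 2) h3 h4 h5 => Y D W; lra.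
apply: le_trans (contraction_drift b mu0 eta0 eta1 (sqr_ge0 _) ha) _.
apply: lerD => //; rewrite [leRHS](_ : _ = (1 + 2 / mu) / eta *
  ((L1 / mu) ^+ 2 * (alpha ^+ 2 * sqr_v s))); last by field; rewrite !gt_eqF.
apply: ler_wpM2l.
  by rewrite divr_ge0 ?addr_ge0 ?divr_ge0 // ltW.
rewrite -(drift_x l0) -exprMn lerXn2r ?nnegrE ?(mulr_ge0 Lmu0)//.
exact: (ystar_lipschitz B).
Qed.

(** The mean direction of [z] is linear in [z - zstar x] with the coercive matrix
[hess22 g], up to the error [r] caused by [y]; the part of the noise that is
proportional to the [z]-error uses up half of the contraction left by the drift. *)
Lemma err_z_step : eta * (64 * L1 ^+ 2) <= mu ->
  mean (fun l => err_z (step l)) <= (1 - eta * (mu / 4)) * err_z s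
    + (1 + 2 / mu) * (2 * cL ^+ 2) * (eta * err_y s)
    + (1 + 2 / mu) * (2 * cz ^+ 2) * (alpha ^+ 2 / eta * sqr_v s)
    + eta ^+ 2 * (varL * err_w s).
Proof.
move=> etaL; pose l0 : T := (Ordinal n0, Ordinal m0).
pose A := hess22 g (pxy p); pose d := pz p - zs x.
pose r := dsubmx (lagrangian_grad f g (pxy p) (zs x)).
pose b := eta *: r + (zs x - zs (px (cur (step l0)))).
pose e := (d - eta *: (A *m d)) + b.
have eE l : err_z (step l) =
    enorm (e + eta *: (dsubmx (X l) - vmean (fun l => dsubmx (X l)))) ^+ 2.
  rewrite /err_z pz_step vmean_dsubmx vX (_ : px _ = px (cur (step l0)))//.
  have -> : dsubmx (Phi p) = r - A *m d.
    rewrite /r /Phi /lagrangian_grad !dsubmxB -!hess22E mulmxBr -/A.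
    by apply/colP => i; rewrite !mxE; ring.
  congr (enorm _ ^+ 2); rewrite /e /b.
  move: (A *m _) (dsubmx (X l)) (zs _) => v1 v2 v3; rewrite /d.
  move: (zs x) => v4; apply/colP => i; rewrite !mxE; ring.
rewrite (eq_mean eE) (mean_sqr_center T0).
have Z0 : 0 <= err_z s by exact: sqr_ge0.
have noise := ler_wpM2l (sqr_ge0 eta) noise_z.
have ha : enorm (d - eta *: (A *m d)) ^+ 2 <= (1 - eta * mu) * err_z s.
  have h1 : mu * err_z s <= dot (A *m d) d := hess22_coercive B x (py p) d.
  have h2 : enorm (A *m d) ^+ 2 <= L1 ^+ 2 * err_z s.
    rewrite -exprMn lerXn2r ?nnegrE ?mulr_ge0// hess22E.
    apply: le_trans (enorm_dsubmx _) _.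
    apply: le_trans (enorm_hess_le _ _ (sb_dg B) (sb_lg B) (sb_hg B) L20) _.
    by rewrite enorm_col_0mx.
  rewrite sqr_enorm_subZ.
  have h3 := ler_wpM2l (sqr_ge0 eta) h2.
  have h4 := ler_wpM2l (ltW eta0) h1.
  have h5 : eta * (eta * (64 * L1 ^+ 2) * err_z s) <= eta * (mu * err_z s).
    by rewrite ler_wpM2l ?(ltW eta0)// ler_wpM2r.
  have h6 := mulr_ge0 (sqr_ge0 eta) (mulr_ge0 (sqr_ge0 L1) Z0).
  have -> : enorm d ^+ 2 = err_z s by [].
  by move: (err_z s) (dot _ _) (enorm (A *m d) ^+ 2) h3 h4 h5 h6 => Y D W; lra.
have hr : enorm r ^+ 2 <= cL ^+ 2 * err_y s.
  rewrite -distXstar -exprMn lerXn2r ?nnegrE ?mulr_ge0//.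
  have -> : r = dsubmx (lagrangian_grad f g (pxy p) (zs x)
      - lagrangian_grad f g (col_mx x (ystar x)) (zs x)).
    by rewrite dsubmxB [X in _ - dsubmx X](lagrangian_grad_star B) col_mxKd subr0.
  apply: le_trans (enorm_dsubmx _) _.
  apply: le_trans (lagrangian_grad_lipschitz B _ _ _ _) _.
  by rewrite subrr enorm0 mulr0 addr0.
have hz : enorm (zs x - zs (px (cur (step l0)))) ^+ 2 <=
    cz ^+ 2 * (alpha ^+ 2 * sqr_v s).
  rewrite -(drift_x l0) -exprMn lerXn2r ?nnegrE ?(mulr_ge0 cz0)//.
  exact: (zstar_lipschitz B).
have hb : enorm b ^+ 2 <= 2 * (eta ^+ 2 * (cL ^+ 2 * err_y s))
    + 2 * (cz ^+ 2 * (alpha ^+ 2 * sqr_v s)).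
  apply: le_trans (sqr_enormZD2 _ _ _) _.
  have := ler_wpM2l (sqr_ge0 eta) hr; lra.
have k0 : 0 <= (1 + 2 / mu) / eta.
  by rewrite divr_ge0 ?addr_ge0 ?divr_ge0 // ltW.
have h1 := contraction_drift b mu0 eta0 eta1 Z0 ha.
have h2 := ler_wpM2l k0 hb.
rewrite [X in _ <= X](_ : _ = (1 + 2 / mu) * (2 * cL ^+ 2) * (eta * err_y s)
    + (1 + 2 / mu) * (2 * cz ^+ 2) * (alpha ^+ 2 / eta * sqr_v s)) in h2; last first.
  by field; rewrite !gt_eqF.
have h3 : eta * (eta * (64 * L1 ^+ 2) * err_z s) <= eta * (mu * err_z s).
  by rewrite ler_wpM2l ?(ltW eta0)// ler_wpM2r.
rewrite -/e in h1; move: h1 h2 noise h3.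
move: (enorm e ^+ 2) (mean _) ((1 + 2 / mu) / eta * _) => E M K.
move: ((1 + 2 / mu) * (2 * cL ^+ 2) * (eta * err_y s)) => K1.
move: ((1 + 2 / mu) * (2 * cz ^+ 2) * (alpha ^+ 2 / eta * sqr_v s)) => K2.
lra.
Qed.

(** The displacement has the mean [dm], made of the mean directions, and the centred
noise [xi], made of the deviations of the estimators of [y] and [z]; the
displacement of [x] is deterministic because the velocity is updated after use. *)
Lemma err_w_step (N : R) : n%:R + m%:R <= N ->
  mean (fun l => err_w (step l)) <= (1 - (2 * N)^-1) * err_w s
    + 18 * N * (alpha ^+ 2 * sqr_v s
        + eta ^+ 2 * ((L1 ^+ 2 + 2 * cL ^+ 2) * err_y s + 2 * L1 ^+ 2 * err_z s))
    + 10 * eta ^+ 2 * ((L1 ^+ 2 + varL) * err_w s + 16 * L1 ^+ 2 * err_z s).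
Proof.
move=> nmN; have [n1 m1] : 1 <= n%:R :> R /\ 1 <= m%:R :> R by rewrite !ler1n.
pose D l := stack (cur (step l)) - stack p.
pose xi l := col_mx (col_mx (0 : 'cV_dx) (- eta *: (dsubmx (U l) - vmean (fun l => dsubmx (U l)))))
  (eta *: (dsubmx (X l) - vmean (fun l => dsubmx (X l)))).
pose dm := col_mx (col_mx (- alpha *: vx s) (- eta *: grad2 g (pxy p))) (eta *: dsubmx (Phi p)).
have DE l : D l = dm + xi l.
  rewrite /D /stack /pxy !col_mxB /dm /xi !add_col_mx addr0 !vmean_dsubmx vU vX.
  rewrite px_step py_step pz_step -/x; congr (col_mx (col_mx _ _) _).
  - by rewrite scaleNr addrC addKr.
  - rewrite /grad2; move: (dsubmx (U l)) (dsubmx (grad _ _)) (py p) => v1 v2 v3.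
    by apply/colP => i; rewrite !mxE; ring.
  - move: (dsubmx (X l)) (dsubmx (Phi p)) (pz p) => v1 v2 v3.
    by apply/colP => i; rewrite !mxE; ring.
have mxi : vmean xi = 0.
  by rewrite !vmean_col_mx vmean_cst// !vmean_center// !col_mx0.
have mD : vmean D = dm.
  by rewrite (eq_vmean DE) vmeanD vmean_cst// mxi addr0.
have sdm : enorm dm ^+ 2 <= alpha ^+ 2 * sqr_v s
    + eta ^+ 2 * ((L1 ^+ 2 + 2 * cL ^+ 2) * err_y s + 2 * L1 ^+ 2 * err_z s).
  rewrite !sqr_enorm_col_mx !sqr_enormZ !sqrrN.
  have h1 := ler_wpM2l (sqr_ge0 eta) sqr_grad2_le.
  have : enorm (dsubmx (Phi p)) ^+ 2 <= 2 * cL ^+ 2 * err_y s + 2 * L1 ^+ 2 * err_z s.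
    apply: le_trans bias_X; rewrite lerXn2r ?nnegrE//.
    rewrite -[dsubmx _]subr0 -[X in _ - X](col_mxKd (Gam x) 0) -dsubmxB.
    exact: enorm_dsubmx.
  move=> /(ler_wpM2l (sqr_ge0 eta)) h2.
  have -> : enorm (vx s) ^+ 2 = sqr_v s by [].
  move: h1 h2; move: (enorm _ ^+ 2) (enorm _ ^+ 2) => a b; lra.
have sxi : mean (fun l => enorm (xi l) ^+ 2) <=
    eta ^+ 2 * ((L1 ^+ 2 + varL) * err_w s + 16 * L1 ^+ 2 * err_z s).
  rewrite (eq_mean (Y := fun l =>
    eta ^+ 2 * enorm (dsubmx (U l) - vmean (fun l => dsubmx (U l))) ^+ 2
    + eta ^+ 2 * enorm (dsubmx (X l) - vmean (fun l => dsubmx (X l))) ^+ 2)); last first.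
    by move=> l; rewrite /xi !sqr_enorm_col_mx !sqr_enormZ enorm0 expr0n add0r sqrrN.
  rewrite meanD !meanZ -mulrDr ler_wpM2l ?sqr_ge0//.
  rewrite [leRHS](_ : _ = L1 ^+ 2 * err_w s
    + (varL * err_w s + 16 * L1 ^+ 2 * err_z s)); last by ring.
  exact: (lerD noise_y noise_z).
have mD2 : mean (fun l => enorm (D l) ^+ 2) <=
   (alpha ^+ 2 * sqr_v s
    + eta ^+ 2 * ((L1 ^+ 2 + 2 * cL ^+ 2) * err_y s + 2 * L1 ^+ 2 * err_z s))
   + eta ^+ 2 * ((L1 ^+ 2 + varL) * err_w s + 16 * L1 ^+ 2 * err_z s).
  rewrite (mean_sqr T0) mD; apply: lerD sdm _; apply: le_trans sxi.
  by apply: mean_le => l; rewrite DE addrC addKr.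
have sf := mem_error_step (memf s) p (fun l : T => cur (step l)) n0 T0
  (fun X => mean_fst cm0 X).
have sg := mem_error_step (memg s) p (fun l : T => cur (step l)) m0 T0
  (fun X => mean_snd cn0 X).
have {}sf := sf N _; have {}sg := sg N _.
have nN : n%:R <= N by lra.
have mN : m%:R <= N by lra.
have {}sf := sf nN; have {}sg := sg mN.
rewrite -/D mD in sf sg.
have -> : mean (fun l => err_w (step l)) =
   mean (fun l => mem_error (remember (memf s) l.1 p) (cur (step l))) +
   mean (fun l => mem_error (remember (memg s) l.2 p) (cur (step l))).
  by rewrite -meanD.
apply: le_trans (lerD sf sg) _.
have N1 : 1 <= N by lra.
set bE := (X in _ <= X) in sdm; set bX := (X in _ <= X) in sxi.
rewrite [leRHS](_ : _ = (1 - (2 * N)^-1) * (mem_error (memf s) p + mem_error (memg s) p)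
  + 18 * (N * bE) + 10 * bX); last by rewrite /bE /bX /err_w; ring.
have {}mD2 : mean (fun l => enorm (D l) ^+ 2) <= bE + bX by [].
have E0 := le_trans (sqr_ge0 _) sdm; have h2 : 0 <= N by lra.
have h3 := ler_wpM2l h2 sdm; have h4 := ler_wpM2r E0 N1; rewrite mul1r in h4.
move: (bE) (bX) (mean (fun l => enorm (D l) ^+ 2)) (enorm dm ^+ 2) h3 h4 mD2.
move: (mem_error _ _) (mem_error _ _) ((2 * N)^-1) => a b c b1 b2 M E h3 h4 h5.
lra.
Qed.

End Step.
End OneStep.

(** * The Lyapunov function *)

(** The weights are chosen one after the other: [b_z] lets the contraction of the
[z]-error pay for its effect on the velocity and on the memories, [b_y] in
addition for the effect of the [y]-error on [z], and the weight [l] of the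
memories is as large as the noise that it must absorb. Every displacement of [x]
carries a further factor [eps], which is taken last and makes the decrease
[- alpha / 2 * u] dominate. *)
Lemma lyapunov_step (R : realType) (La kap eps eta N l b_y b_z : R)
    (H h u V Y Z W H' V' Y' Z' W' : R) (alpha := eps * eta) :
  0 < La -> 0 < eps -> eps <= 1 -> 0 < eta -> eta <= 1 -> 0 <= N -> 0 <= l ->
  0 <= b_y -> 0 <= b_z -> b_z * kap = 3 * La -> b_y * kap = 3 * La + La * b_z ->
  2 * La * eps * (3 + b_y + b_z) <= 1 -> l * N * eta <= 1 ->
  eta ^+ 2 * La * (1 + b_y + b_z) + l * La * eta ^+ 2 <= l * (2 * N)^-1 ->
  0 <= u -> 0 <= V -> 0 <= Y -> 0 <= Z -> 0 <= W ->
  H' <= H - alpha / 2 * h - alpha / 2 * u + alpha / 2 * V + La * (alpha ^+ 2 * u) ->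
  V' <= (1 - eta) * V + La * (alpha ^+ 2 / eta * u) + eta * (La * (Y + Z))
    + eta ^+ 2 * (La * W) ->
  Y' <= (1 - eta * kap) * Y + La * (alpha ^+ 2 / eta * u) + eta ^+ 2 * (La * W) ->
  Z' <= (1 - eta * kap) * Z + La * (eta * Y) + La * (alpha ^+ 2 / eta * u)
    + eta ^+ 2 * (La * W) ->
  W' <= (1 - (2 * N)^-1) * W + N * La * (alpha ^+ 2 * u + eta ^+ 2 * (Y + Z))
    + eta ^+ 2 * (La * W) ->
  H' + eps * (V' + b_y * Y' + b_z * Z' + l * W') <=
  H + eps * (V + b_y * Y + b_z * Z + l * W) - alpha / 2 * h.
Proof.
move=> La0 e0 e1 eta0 eta1 N0 l0 by0 bz0 hbz hby heps ht hl u0 V0 Y0 Z0 W0.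
have -> : alpha ^+ 2 / eta = eps ^+ 2 * eta by rewrite /alpha; field; rewrite gt_eqF.
move=> hH hV hY hZ hW.
set t := l * N * eta in ht.
have t0 : 0 <= t by rewrite !mulr_ge0// ltW.
(* [Ku] is the coefficient of [eps * eta * u] in the total change. *)
pose Ku := - 2^-1 + La * eps * eta + eps ^+ 2 * La * (1 + b_y + b_z) + eps ^+ 2 * La * t.
have LLe : 0 < La * eps by rewrite mulr_gt0.
have Ku0 : Ku <= 0.
  have h1 : La * eps * eta <= La * eps by rewrite ler_piMr// ltW.
  have e2 : eps ^+ 2 * La <= La * eps.
    by rewrite [leLHS](_ : _ = La * eps * eps); [rewrite ler_piMr// ltW|ring].
  have h2 : eps ^+ 2 * La * (1 + b_y + b_z) <= La * eps * (1 + b_y + b_z).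
    by rewrite ler_wpM2r//; lra.
  have h3 : eps ^+ 2 * La * t <= La * eps.
    by apply: le_trans e2; rewrite ler_piMr// mulr_ge0 ?sqr_ge0// ltW.
  rewrite /Ku; lra.
have Lat : La * t <= La by rewrite ler_piMr// ltW.
have ee : 0 < eps * eta by rewrite mulr_gt0.
have iu : eps * eta * u * Ku <= 0 by rewrite mulr_ge0_le0// mulr_ge0// ltW.
have iV : eps * eta * V * (2^-1 - 1) <= 0.
  by rewrite mulr_ge0_le0//; [rewrite mulr_ge0// ltW|lra].
have iY : eps * eta * Y * (La + b_z * La + La * t - b_y * kap) <= 0.
  by rewrite mulr_ge0_le0//; [rewrite mulr_ge0// ltW|lra].
have iZ : eps * eta * Z * (La + La * t - b_z * kap) <= 0.
  by rewrite mulr_ge0_le0//; [rewrite mulr_ge0// ltW|lra].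
have iW : eps * W * (eta ^+ 2 * La * (1 + b_y + b_z) + l * La * eta ^+ 2
    - l * (2 * N)^-1) <= 0.
  by rewrite mulr_ge0_le0//; [rewrite mulr_ge0// ltW|lra].
have {}hV := ler_wpM2l (ltW e0) hV.
have {}hY := ler_wpM2l (mulr_ge0 (ltW e0) by0) hY.
have {}hZ := ler_wpM2l (mulr_ge0 (ltW e0) bz0) hZ.
have {}hW := ler_wpM2l (mulr_ge0 (ltW e0) l0) hW.
have := lerD (lerD (lerD (lerD hH hV) hY) hZ) hW.
move=> /le_trans h1.
rewrite [leLHS](_ : _ = H' + eps * V' + eps * b_y * Y' + eps * b_z * Z'
  + eps * l * W'); last by ring.
apply: h1; rewrite -subr_le0.
(* The total change, grouped by the quantity that it multiplies. *)
rewrite [leLHS](_ : _ = eps * eta * u * Ku + eps * eta * V * (2^-1 - 1)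
  + eps * eta * Y * (La + b_z * La + La * t - b_y * kap)
  + eps * eta * Z * (La + La * t - b_z * kap)
  + eps * W * (eta ^+ 2 * La * (1 + b_y + b_z) + l * La * eta ^+ 2
    - l * (2 * N)^-1)); first by lra.
rewrite /Ku /t /alpha; ring.
Qed.

Section Constants.
Variables (R : realType) (Lf Cf L1 L2 mu : R).

(** A common bound for all the coefficients in the one-step estimates. *)
Definition step_const : R :=
  18 + 300 * L1 ^+ 2 + 40 * lipL Lf Cf L2 mu ^+ 2 + 2 * lipH Lf Cf L1 L2 mu ^+ 2
  + (1 + 2 / mu) * ((L1 / mu) ^+ 2 + 2 * lipL Lf Cf L2 mu ^+ 2
                    + 2 * lipz Lf Cf L1 L2 mu ^+ 2)
  + 10 * varL Lf Cf L1 L2 mu + lipL Lf Cf L2 mu * lipy L1 mu ^+ 2.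

Definition weight_z : R := 3 * step_const / (mu / 4).
Definition weight_y : R := (3 * step_const + step_const * weight_z) / (mu / 4).
Definition weight_w : R := 4 * step_const * (1 + weight_y + weight_z).

(** The summands after [1] make [eta] small enough, in this order, for the mean
displacement charged to the memories, for the noise that feeds back into the
memories, and for the contractions of [y] and [z]. *)
Definition step_eta : R :=
  (1 + weight_w + 4 * step_const + 64 * L1 ^+ 2 / mu)^-1.
Definition step_ratio : R := (2 * step_const * (3 + weight_y + weight_z))^-1.

Hypotheses (Lf0 : 0 <= Lf) (Cf0 : 0 < Cf) (L10 : 0 <= L1) (L20 : 0 <= L2).
Hypothesis mu0 : 0 < mu.

Let cL := lipL Lf Cf L2 mu.
Let cz := lipz Lf Cf L1 L2 mu.
Let cH := lipH Lf Cf L1 L2 mu.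
Let cy := lipy L1 mu.
Let vL := varL Lf Cf L1 L2 mu.

Let cL0 : 0 <= cL.
Proof. by rewrite addr_ge0// mulr_ge0// divr_ge0// ltW. Qed.

Lemma step_const_bounds (La := step_const) :
  [/\ [/\ 18 <= La, 18 * (L1 ^+ 2 + 2 * cL ^+ 2) <= La & 196 * L1 ^+ 2 <= La],
      [/\ 4 * cL ^+ 2 <= La, 2 * cH ^+ 2 <= La, vL <= La
        & 10 * (L1 ^+ 2 + vL) <= La],
      [/\ (1 + 2 / mu) * (L1 / mu) ^+ 2 <= La, (1 + 2 / mu) * (2 * cL ^+ 2) <= La
        & (1 + 2 / mu) * (2 * cz ^+ 2) <= La]
    & [/\ cL * cy ^+ 2 <= La, 20 * L1 ^+ 2 <= La & L1 ^+ 2 <= La]].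
Proof.
rewrite /La /step_const -/cL -/cz -/cH -/cy -/vL.
have k0 : 0 <= 1 + 2 / mu by rewrite addr_ge0// divr_ge0// ltW.
have a1 := sqr_ge0 L1; have a2 := sqr_ge0 cL; have a3 := sqr_ge0 cH.
have v0 : 0 <= vL by rewrite mulr_ge0// sqr_ge0.
have y0 : 0 <= cL * cy ^+ 2 by rewrite mulr_ge0// sqr_ge0.
rewrite !mulrDr; have b1 := mulr_ge0 k0 (sqr_ge0 (L1 / mu)).
have b2 : 0 <= (1 + 2 / mu) * (2 * cL ^+ 2) by rewrite mulr_ge0// mulr_ge0.
have b3 : 0 <= (1 + 2 / mu) * (2 * cz ^+ 2) by rewrite mulr_ge0// mulr_ge0// sqr_ge0.
move: a1 a2 a3 v0 y0 b1 b2 b3.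
move: ((1 + 2 / mu) * _) ((1 + 2 / mu) * _) ((1 + 2 / mu) * _) (cL * _).
move: (L1 ^+ 2) (cL ^+ 2) (cH ^+ 2) vL => a b c d e f h i *.
by split; split; lra.
Qed.

Lemma step_const_gt0 : 0 < step_const.
Proof. by have [[h _ _] _ _ _] := step_const_bounds; lra. Qed.

Lemma weight_z_ge0 : 0 <= weight_z.
Proof. by rewrite divr_ge0 ?mulr_ge0 ?divr_ge0 // ltW ?step_const_gt0. Qed.

Lemma weight_y_ge0 : 0 <= weight_y.
Proof.
have [hL hz] := (step_const_gt0, weight_z_ge0).
apply: divr_ge0; last by rewrite divr_ge0// ltW.
exact: addr_ge0 (mulr_ge0 (ler0n _ 3) (ltW hL)) (mulr_ge0 (ltW hL) hz).
Qed.

Lemma weight_w_ge0 : 0 <= weight_w.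
Proof.
have [[hL hz] hy] := (step_const_gt0, weight_z_ge0, weight_y_ge0).
apply: mulr_ge0; last by lra.
exact: mulr_ge0 (ler0n _ 4) (ltW hL).
Qed.

Lemma weight_zE : weight_z * (mu / 4) = 3 * step_const.
Proof. by rewrite /weight_z; field; rewrite gt_eqF. Qed.

Lemma weight_yE : weight_y * (mu / 4) = 3 * step_const + step_const * weight_z.
Proof. by rewrite /weight_y divfK// gt_eqF// divr_gt0. Qed.

Lemma step_ratio_gt0 : 0 < step_ratio.
Proof.
have [[hL hz] hy] := (step_const_gt0, weight_z_ge0, weight_y_ge0).
by rewrite invr_gt0 mulr_gt0 ?mulr_gt0//; lra.
Qed.

Lemma step_ratioP :
  2 * step_const * step_ratio * (3 + weight_y + weight_z) <= 1.
Proof.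
have [[hL hz] hy] := (step_const_gt0, weight_z_ge0, weight_y_ge0).
rewrite mulrAC divff// mulf_neq0// gt_eqF//; last lra.
by rewrite mulr_gt0.
Qed.

Lemma step_ratio_le1 : step_ratio <= 1.
Proof.
have [[hL hz] hy] := (step_const_gt0, weight_z_ge0, weight_y_ge0).
have [[h _ _] _ _ _] := step_const_bounds.
have h1 := step_ratioP; have e0 := step_ratio_gt0.
have h2 : step_ratio * 1 <= step_ratio * (2 * step_const * (3 + weight_y + weight_z)).
  rewrite ler_pM2l//; apply: le_trans (_ : 2 * step_const * 1 <= _); first lra.
  by rewrite ler_pM2l ?mulr_gt0//; lra.
rewrite mulr1 in h2; apply: le_trans h2 _; apply: le_trans _ h1.
by rewrite le_eqVlt; apply/orP; left; apply/eqP; ring.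
Qed.

Lemma step_etaP : [/\ 0 < step_eta, step_eta <= 1, weight_w * step_eta <= 1,
  4 * step_const * step_eta <= 1 & step_eta * (64 * L1 ^+ 2) <= mu].
Proof.
have [hL hw] := (step_const_gt0, weight_w_ge0).
have hL1 : 0 <= 64 * L1 ^+ 2 / mu by rewrite divr_ge0 ?mulr_ge0 ?sqr_ge0// ltW.
set D := 1 + weight_w + 4 * step_const + 64 * L1 ^+ 2 / mu.
have D0 : 0 < D by rewrite /D; lra.
rewrite /step_eta -/D; split.
- by rewrite invr_gt0.
- by rewrite invf_le1// /D; lra.
- by rewrite ler_pdivrMr// mul1r /D; lra.
- by rewrite ler_pdivrMr// mul1r /D; lra.
rewrite mulrC ler_pdivrMr// -ler_pdivrMl// mulrC /D; lra.
Qed.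

End Constants.

Section Decrease.
Variables (R : realType) (dx dy n m : nat).
Variables (F : 'I_n -> 'cV[R]_(dx + dy) -> R) (G : 'I_m -> 'cV[R]_(dx + dy) -> R).
Variables (ystar : 'cV[R]_dx -> 'cV[R]_dy) (Lf Cf L1 L2 mu : R).
Hypothesis FB : finite_sum_bilevel F G ystar Lf Cf L1 L2 mu.

Let B := fs_B FB.
Let Lf0 := sb_Lf B.
Let Cf0 := sb_Cf B.
Let L10 := sb_L1 B.
Let L20 := sb_L2 B.
Let mu0 := sb_mu B.
Let La := step_const Lf Cf L1 L2 mu.
Let b_y := weight_y Lf Cf L1 L2 mu.
Let b_z := weight_z Lf Cf L1 L2 mu.
Let b_w := weight_w Lf Cf L1 L2 mu.
Let c := step_eta Lf Cf L1 L2 mu.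
Let eps := step_ratio Lf Cf L1 L2 mu.
Let La0 : 0 < La := step_const_gt0 L1 Lf0 Cf0 L20 mu0.

(** [q] stands for [N^(-2/3)]; the relation [N^2 q^3 = 1] avoids real powers. *)
Variables (N q : R).
Hypotheses (nmN : n%:R + m%:R <= N) (q0 : 0 < q) (q1 : q <= 1).
Hypothesis Nq : N ^+ 2 * q ^+ 3 = 1.

(** The weight of the memories is of order [N q^2 = N^(-1/3)]: divided by the
lifetime [N] of a memory it matches the noise, of order [q^2]. *)
Definition lyapunov (s : saba_state R dx dy n m) : R :=
  upper_value (avg F) ystar (px (cur s)) + eps * (err_v F G ystar s
    + b_y * err_y ystar s + b_z * err_z F G ystar s
    + b_w * c ^+ 2 * (q ^+ 2 * N) * err_w s).

Lemma lyapunov_ge (s : saba_state R dx dy n m) :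
  upper_value (avg F) ystar (px (cur s)) <= lyapunov s.
Proof.
have N0 : 0 <= N by apply: le_trans nmN; rewrite -natrD ler0n.
have wy := weight_y_ge0 L1 Lf0 Cf0 L20 mu0.
have wz := weight_z_ge0 L1 Lf0 Cf0 L20 mu0.
have ww := weight_w_ge0 L1 Lf0 Cf0 L20 mu0.
rewrite lerDl; apply: mulr_ge0 (ltW (step_ratio_gt0 L1 Lf0 Cf0 L20 mu0)) _.
have W := mulr_ge0 (mulr_ge0 (mulr_ge0 ww (sqr_ge0 c)) (mulr_ge0 (sqr_ge0 q) N0)) (err_w_ge0 s).
exact: addr_ge0 (addr_ge0 (addr_ge0 (sqr_ge0 _) (mulr_ge0 wy (sqr_ge0 _)))
  (mulr_ge0 wz (sqr_ge0 _))) W.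
Qed.

Lemma lyapunov_decrease (s : saba_state R dx dy n m) :
  mean (fun l => lyapunov (pair_step F G (eps * (c * q)) (c * q) s l)) <=
  lyapunov s - eps * (c * q) / 2 *
    enorm (grad (upper_value (avg F) ystar) (px (cur s))) ^+ 2.
Proof.
have T0 : (0 < #|{: 'I_n * 'I_m}|)%N.
  by rewrite card_pair_gt0 ?card_ord ?(fs_n FB) ?(fs_m FB).
have [c0 c1 cw cL cL1] := step_etaP Lf0 Cf0 L10 L20 mu0.
rewrite -/c -/La -/b_w in c0 c1 cw cL cL1.
have e0 : 0 < eps := step_ratio_gt0 L1 Lf0 Cf0 L20 mu0.
have e1 : eps <= 1 := step_ratio_le1 L1 Lf0 Cf0 L20 mu0.
have by0 : 0 <= b_y := weight_y_ge0 L1 Lf0 Cf0 L20 mu0.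
have bz0 : 0 <= b_z := weight_z_ge0 L1 Lf0 Cf0 L20 mu0.
have bw0 : 0 <= b_w := weight_w_ge0 L1 Lf0 Cf0 L20 mu0.
have eta0 : 0 < c * q by rewrite mulr_gt0.
have eta_c : c * q <= c by rewrite ler_piMr// ltW.
have eta1 : c * q <= 1 := le_trans eta_c c1.
have a0 : 0 < eps * (c * q) by rewrite mulr_gt0.
have N1 : 1 <= N.
  by apply: le_trans nmN; rewrite -natrD ler1n addn_gt0 (fs_n FB).
have Np : 0 < N := lt_le_trans ltr01 N1.
have N0 := ltW Np.
have [[k1 k2 k3] [k4 k5 k6 k7] [k8 k9 k10] [k11 k12 k13]] :=
  step_const_bounds L1 Lf0 Cf0 L20 mu0.
rewrite -/La in k1 k2 k3 k4 k5 k6 k7 k8 k9 k10 k11 k12 k13.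
have etaL1 : c * q * (64 * L1 ^+ 2) <= mu.
  by apply: le_trans cL1; rewrite ler_wpM2r// mulr_ge0// sqr_ge0.
have etaL1' : c * q * L1 ^+ 2 <= mu.
  apply: le_trans etaL1; rewrite ler_pM2l//.
  by have := sqr_ge0 L1; lra.
set eta := c * q in eta0 eta_c eta1 a0 etaL1 etaL1' *; set alpha := eps * eta in a0 *.
have ae0 : 0 <= alpha ^+ 2 / eta by rewrite divr_ge0 ?sqr_ge0// ltW.
have u0 : 0 <= sqr_v s := sqr_ge0 _.
have V0 : 0 <= err_v F G ystar s := sqr_ge0 _.
have Y0 : 0 <= err_y ystar s := sqr_ge0 _.
have Z0 : 0 <= err_z F G ystar s := sqr_ge0 _.
have W0 : 0 <= err_w s := err_w_ge0 _.
have eta2 : eta ^+ 2 <= eta by rewrite expr2 ler_piMr// ltW.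
have hv : mean (fun l => err_v F G ystar (pair_step F G alpha eta s l)) <=
    (1 - eta) * err_v F G ystar s + La * (alpha ^+ 2 / eta * sqr_v s)
    + eta * (La * (err_y ystar s + err_z F G ystar s)) + eta ^+ 2 * (La * err_w s).
  apply: le_trans (err_v_step FB s alpha eta0 eta1) _; rewrite -/eta.
  have m1 := ler_wpM2r (mulr_ge0 ae0 u0) k5.
  have m2 := ler_wpM2l (ltW eta0) (ler_wpM2r Y0 k4).
  have m3 := ler_wpM2l (ltW eta0) (ler_wpM2r Z0 k12).
  have m4 := ler_wpM2l (sqr_ge0 eta) (ler_wpM2r W0 k6).
  have m5 := ler_wpM2r (mulr_ge0 (sqr_ge0 L1) Z0) eta2.
  lra.
have hy : mean (fun l => err_y ystar (pair_step F G alpha eta s l)) <=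
    (1 - eta * (mu / 4)) * err_y ystar s + La * (alpha ^+ 2 / eta * sqr_v s)
    + eta ^+ 2 * (La * err_w s).
  apply: le_trans (err_y_step FB s alpha eta0 eta1 etaL1') _; rewrite -/eta.
  have m1 := ler_wpM2r (mulr_ge0 ae0 u0) k8.
  have m2 := ler_wpM2l (sqr_ge0 eta) (ler_wpM2r W0 k13).
  have m3 := mulr_ge0 (mulr_ge0 (ltW eta0) (ltW mu0)) Y0.
  lra.
have hz : mean (fun l => err_z F G ystar (pair_step F G alpha eta s l)) <=
    (1 - eta * (mu / 4)) * err_z F G ystar s + La * (eta * err_y ystar s)
    + La * (alpha ^+ 2 / eta * sqr_v s) + eta ^+ 2 * (La * err_w s).
  apply: le_trans (err_z_step FB s alpha eta0 eta1 etaL1) _; rewrite -/eta.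
  have m1 := ler_wpM2r (mulr_ge0 ae0 u0) k10.
  have m2 := ler_wpM2r (mulr_ge0 (ltW eta0) Y0) k9.
  have m3 := ler_wpM2l (sqr_ge0 eta) (ler_wpM2r W0 k6).
  lra.
have hw : mean (fun l => err_w (pair_step F G alpha eta s l)) <=
    (1 - (2 * N)^-1) * err_w s + N * La * (alpha ^+ 2 * sqr_v s
      + eta ^+ 2 * (err_y ystar s + err_z F G ystar s)) + eta ^+ 2 * (La * err_w s).
  apply: le_trans (err_w_step FB s alpha eta nmN) _.
  have m1 := ler_wpM2r (mulr_ge0 N0 (mulr_ge0 (sqr_ge0 alpha) u0)) k1.
  have m2 := ler_wpM2r (mulr_ge0 N0 (mulr_ge0 (sqr_ge0 eta) Y0)) k2.
  have m3 := ler_wpM2r (mulr_ge0 N0 (mulr_ge0 (sqr_ge0 eta) Z0)) k3.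
  have m4 := ler_wpM2l (sqr_ge0 eta) (ler_wpM2r W0 k7).
  have m5 := ler_wpM2r (mulr_ge0 (mulr_ge0 (sqr_ge0 eta) (sqr_ge0 L1)) Z0) N1.
  lra.
pose H l := upper_value (avg F) ystar (px (cur (pair_step F G alpha eta s l))).
set h := enorm (grad _ _) ^+ 2.
have hH : mean H <= upper_value (avg F) ystar (px (cur s)) - alpha / 2 * h
    - alpha / 2 * sqr_v s + alpha / 2 * err_v F G ystar s + La * (alpha ^+ 2 * sqr_v s).
  apply: (mean_le_cst T0) => l; apply: le_trans (descent_step FB s alpha eta l) _.
  rewrite -[X in enorm X](grad_upper_value B) lerD2l ler_wpM2r//.
  by rewrite mulr_ge0// sqr_ge0.
have q2N : q ^+ 2 * N <= 1.
  have qN0 : 0 <= q ^+ 2 * N by rewrite mulr_ge0// sqr_ge0.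
  rewrite -(ler_pXn2r (n := 2))// ?nnegrE// expr1n.
  by rewrite [leLHS](_ : _ = N ^+ 2 * q ^+ 3 * q); [rewrite Nq mul1r|ring].
have c2 : c ^+ 2 <= 1 by rewrite expr_le1// ltW.
have l0 : 0 <= b_w * c ^+ 2 * (q ^+ 2 * N).
  exact: mulr_ge0 (mulr_ge0 bw0 (sqr_ge0 c)) (mulr_ge0 (sqr_ge0 q) N0).
have lN : b_w * c ^+ 2 * (q ^+ 2 * N) * N * eta <= 1.
  rewrite [leLHS](_ : _ = b_w * c * c ^+ 2 * (N ^+ 2 * q ^+ 3)); last by rewrite /eta; ring.
  rewrite Nq mulr1; apply: le_trans cw; rewrite ler_piMr//; exact: mulr_ge0 bw0 (ltW c0).
have hl : eta ^+ 2 * La * (1 + b_y + b_z) + b_w * c ^+ 2 * (q ^+ 2 * N) * La * eta ^+ 2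
    <= b_w * c ^+ 2 * (q ^+ 2 * N) * (2 * N)^-1.
  rewrite [leRHS](_ : _ = eta ^+ 2 * (b_w / 2)); last first.
    by rewrite /eta; field; rewrite gt_eqF.
  rewrite [leLHS](_ : _ = eta ^+ 2 * (b_w / 4 + b_w * (c ^+ 2 * La) * (q ^+ 2 * N))); last first.
    by rewrite /b_w /weight_w -/La -/b_y -/b_z; field.
  rewrite ler_wpM2l ?sqr_ge0//.
  have cLa : c ^+ 2 * La <= 4^-1.
    have m1 := ler_wpM2r (ltW La0) (ler_wpM2l (ltW c0) c1).
    by rewrite mulr1 -expr2 in m1; lra.
  have cLa0 : 0 <= c ^+ 2 * La by rewrite mulr_ge0 ?sqr_ge0// ltW.
  have m1 : b_w * (c ^+ 2 * La) * (q ^+ 2 * N) <= b_w * (c ^+ 2 * La).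
    by rewrite ler_piMr//; exact: mulr_ge0 bw0 cLa0.
  have m2 := ler_wpM2l bw0 cLa.
  lra.
have main := lyapunov_step La0 e0 e1 eta0 eta1 N0 l0 by0 bz0 (weight_zE Lf Cf L1 L2 mu0)
  (weight_yE Lf Cf L1 L2 mu0) (step_ratioP L1 Lf0 Cf0 L20 mu0) lN hl u0 V0 Y0 Z0 W0
  hH hv hy hz hw.
rewrite /lyapunov meanD [X in _ + X <= _]meanZ !(meanD (fun l => _ + _)) !(meanD (fun l => err_v _ _ _ _)).
rewrite (meanZ b_y) (meanZ b_z) (meanZ (b_w * _ * _)).
exact: main.
Qed.

End Decrease.

(** * Expectations over the sampled indices as finite averages *)

(** The last index is the outer component, so that it can be averaged first, given
the past. *)
Fixpoint history (L : finType) (k : nat) : finType :=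
  if k is k'.+1 then (history L k' * L)%type : finType else L.

Fixpoint entry (L : finType) (k : nat) : history L k -> nat -> L :=
  match k with
  | 0 => fun h _ => h
  | k'.+1 => fun h t => if t == k'.+1 then h.2 else entry h.1 t
  end.

Fixpoint history_of (L : finType) (a : nat -> L) (k : nat) : history L k :=
  match k with
  | 0 => a 0%N
  | k'.+1 => (history_of a k', a k'.+1)
  end.

Lemma entry_history_of (L : finType) (a : nat -> L) k t : (t <= k)%N ->
  entry (history_of a k) t = a t.
Proof.
elim: k => [|k IH]; first by rewrite leqn0 => /eqP ->.
by rewrite leq_eqVlt /= => /orP[/eqP ->|tk]; rewrite ?eqxx// ltn_eqF// IH.
Qed.

Lemma eq_history_of (L : finType) (a : nat -> L) k (h : history L k) :
  (forall t, (t <= k)%N -> a t = entry h t) -> history_of a k = h.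
Proof.
elim: k h => [|k IH] h ah /=; first exact: ah.
case: h ah => h l ah; congr (_, _); last by rewrite ah//= eqxx.
by apply: IH => t tk; rewrite ah ?(leqW tk)//= ltn_eqF.
Qed.

Lemma card_history (L : finType) k : #|history L k| = (#|L| ^ k.+1)%N.
Proof.
elim: k => [|k IH]; first by rewrite expn1.
by rewrite expnSr -IH -card_prod.
Qed.

Section Sampling.
Local Open Scope classical_set_scope.
Local Open Scope ring_scope.
Context (R : realType) (d : measure_display) (T : measurableType d).
Variables (P : probability T R) (n m : nat).
Variables (I : nat -> T -> 'I_n) (J : nat -> T -> 'I_m).
Hypothesis IJ : independent_uniform_indices P I J.

Let sample (k : nat) (w : T) := history_of (fun t => (I t w, J t w)) k.

Let event (k : nat) (h : history ('I_n * 'I_m)%type k) :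
  [set w | sample k w = h] =
  \bigcap_(t in [set t | (t < k.+1)%N])
    (I t @^-1` [set (entry h t).1] `&` J t @^-1` [set (entry h t).2]).
Proof.
apply/seteqP; split => w /=.
  by move=> <- t /= tk; rewrite entry_history_of.
move=> hw; apply: eq_history_of => t tk; have [/= -> ->] := hw t tk.
by rewrite -surjective_pairing.
Qed.

Lemma measurable_history k h : measurable [set w | sample k w = h].
Proof.
have [uI uJ _] := IJ; rewrite event; apply: bigcap_measurableType => t _.
by apply: measurableI; [have [] := uI t (entry h t).1|have [] := uJ t (entry h t).2].
Qed.

Lemma probability_history k h :
  P [set w | sample k w = h] = (#|history ('I_n * 'I_m)%type k|%:R^-1)%:E.
Proof.
have [uI uJ ind] := IJ; rewrite event.
rewrite (ind k.+1 (fun t => [set (entry h t).1]) (fun t => [set (entry h t).2])).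
rewrite (eq_bigr (fun=> (((n * m)%:R : R)^-1)%:E)) => [|t _]; last first.
  have [_ ->] := uI t (entry h t).1; have [_ ->] := uJ t (entry h t).2.
  by rewrite natrM invfM EFinM.
by rewrite prodEFin prodr_const card_ord card_history card_prod !card_ord natrX exprVn.
Qed.

(** The histories up to time [k] are uniform, so a function of the history takes
finitely many values with equal weights. *)
Lemma expectation_history k (psi : history ('I_n * 'I_m)%type k -> R) :
  (forall h, 0 <= psi h)%R -> ('E_P[fun w => psi (sample k w)] = (mean psi)%:E)%E.
Proof.
move=> psi0; rewrite unlock.
under eq_integral => w _.
  have -> : (psi (sample k w))%:E =
    (\sum_(h : history ('I_n * 'I_m)%type k)
      (psi h)%:E * (\1_[set w | sample k w = h] w)%:E)%E.
    rewrite (bigD1 (sample k w))//= big1 ?adde0 => [|h hw].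
      by rewrite indicE mem_set// mule1.
    by rewrite indicE memNset ?mule0//= => e; rewrite e eqxx in hw.
  over.
rewrite ge0_integral_sum//; last 2 first.
- move=> h; apply: measurable_funeM; apply/measurable_EFinP.
  by apply: measurable_indic; exact: measurable_history.
- by move=> h w _; rewrite mule_ge0// lee_fin.
rewrite /mean mulr_sumr -sumEFin; apply: eq_bigr => h _.
rewrite ge0_integralZl_EFin//; last first.
  by apply/measurable_EFinP; apply: measurable_indic; exact: measurable_history.
rewrite integral_indic ?setIT//; last exact: measurable_history.
by rewrite [X in (_ * X)%E](probability_history h) -EFinM mulrC.
Qed.

End Sampling.

(** * The initial value of the Lyapunov function *)

Section Initial.
Variables (R : realType) (dx dy n m : nat).
Variables (F : 'I_n -> 'cV[R]_(dx + dy) -> R) (G : 'I_m -> 'cV[R]_(dx + dy) -> R).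
Variables (ystar : 'cV[R]_dx -> 'cV[R]_dy) (Lf Cf L1 L2 mu : R).
Hypothesis FB : finite_sum_bilevel F G ystar Lf Cf L1 L2 mu.

Let B := fs_B FB.
Let n0 := fs_n FB.
Let m0 := fs_m FB.
Let Lf0 := sb_Lf B.
Let Cf0 := sb_Cf B.
Let L10 := sb_L1 B.
Let L20 := sb_L2 B.
Let mu0 := sb_mu B.
Let f := avg F.
Let g := avg G.
Let H := upper_value f ystar.
Let Gam := hypergrad f g ystar.
Let zs := zstar f g ystar.

Let Q := lipL Lf Cf L2 mu * lipy L1 mu ^+ 2.
Let Q0 : 0 <= Q. Proof. exact: mulr_ge0 (lipL_ge0 B) (sqr_ge0 _). Qed.
Let cB := bndz Cf mu.
Let cB0 : 0 <= cB := bndz_ge0 B.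
Let cL := lipL Lf Cf L2 mu.
Let cL0 : 0 <= cL := lipL_ge0 B.

(** A gradient step decreases a smooth function by a multiple of the squared
gradient, which is therefore bounded by the gap to the infimum. *)
Lemma hypergrad_gap x b : (forall x', H x - H x' <= b) ->
  enorm (Gam x) ^+ 2 <= 2 * b * (2 * Q + 1).
Proof.
have hQ := Q0; move=> gap; have D0 : 0 < 2 * Q + 1 by lra.
pose t := (2 * Q + 1)^-1; have t0 : 0 < t by rewrite invr_gt0.
have tD : t * (2 * Q + 1) = 1 by rewrite mulVf// gt_eqF.
have h1 := gap (x - t *: Gam x).
have := upper_value_quadratic B x (x - t *: Gam x); rewrite -/f -/H -/Gam -/Q.
rewrite [x - _ - x]addrC addKr dotNr dotZr enormN sqr_enormZ -enorm_sqr.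
rewrite ler_norml => /andP[_ h2].
move: (enorm (Gam x) ^+ 2) (sqr_ge0 (enorm (Gam x))) h2 => a a0 h2.
have h3 : t * a - Q * (t ^+ 2 * a) <= b by lra.
have h4 : Q * (t ^+ 2 * a) = t * a * (Q * t) by ring.
have h5 : t * a * (Q * t) <= t * a * 2^-1.
  by rewrite ler_wpM2l ?mulr_ge0 ?(ltW t0)//; lra.
have h6 : t * a <= 2 * b by lra.
have := ler_wpM2r (ltW D0) h6.
by rewrite mulrAC tD mul1r.
Qed.

Variables (sm1 : saba_state R dx dy n m) (p0 : triple R dx dy) (b : R).
Hypothesis gap : forall x, H (px p0) - H x <= b.
Hypothesis by0 : enorm (py p0 - ystar (px p0)) <= b.
Hypothesis bz0 : enorm (pz p0) <= b.
Hypothesis bv : enorm (vx sm1) <= b.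
Hypothesis bcur : pdist (cur sm1) p0 <= b.
Hypothesis bf : forall i, pdist (memf sm1 i) p0 <= b.
Hypothesis bg : forall j, pdist (memg sm1 j) p0 <= b.

Let b0 : 0 <= b := le_trans (enorm_ge0 _) bz0.
Let x0 := px p0.

Let saga_dist s d (phi : 'I_s -> triple R dx dy -> 'cV[R]_d) w l p q D : (0 < s)%N ->
  (forall i, enorm (phi i p - phi i (w i)) <= D) ->
  (forall i, enorm (phi i (w i) - phi i q) <= D) ->
  enorm (saga phi w l p - vmean (phi^~ q)) <= 2 * D.
Proof.
move=> s0 h1 h2; have Is0 : (0 < #|'I_s|)%N by rewrite card_ord.
rewrite sagaE -addrA -vmeanB (_ : 2 * D = D + D); last by ring.
apply: le_trans (enormD _ _) _; apply: lerD; first exact: h1.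
apply: le_trans (enorm_vmean_le _) _; exact: (mean_le_cst Is0).
Qed.

Let bz q : pdist q p0 <= b -> enorm (pz q - zs x0) <= 2 * b + cB.
Proof.
move=> qb; apply: le_trans (enorm_dist (pz p0) _ _) _.
have h1 := le_trans (pdist_z q p0) qb.
have h2 := enormB (pz p0) (zs x0); have h3 : enorm (zs x0) <= cB := zstar_bound B x0.
have := bz0; lra.
Qed.

Let pdist2 q r : pdist q p0 <= b -> pdist r p0 <= b -> pdist q r <= 2 * b.
Proof.
move=> h1 h2; apply: le_trans (pdist_triangle p0 _ _) _.
by rewrite (pdistC p0); lra.
Qed.

Let DG := (L1 + L2 * cB) * (2 * b) + 2 * L1 * (2 * b + cB).

(** Only differences of the component maps occur, between points within [2 b] of each
other. *)
Let dir_dist l :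
  enorm (dir_xz F G (memf sm1) (memg sm1) l (cur sm1)
    - lagrangian_grad f g (pxy p0) (pz p0)) <= 2 * (Lf * (2 * b)) + 2 * DG.
Proof.
have -> : lagrangian_grad f g (pxy p0) (pz p0) =
    vmean ((gradF F)^~ p0) - vmean ((hessGz G)^~ p0).
  rewrite /lagrangian_grad /f grad_avg; last by move=> i; exact: (fs_dF FB).
  by rewrite /g hess_avg//; exact: (fs_dG FB).
rewrite /dir_xz; set sf := saga _ _ _ _; set sg := saga _ _ _ _.
set a := vmean _; set c := vmean _.
have -> : sf - sg - (a - c) = (sf - a) - (sg - c).
  by rewrite !opprB addrACA [RHS]addrACA [- _ - _]addrC.
apply: le_trans (enormB _ _) _; apply: lerD.
  apply: saga_dist => // i; (apply: le_trans (fs_lF FB i _ _) _);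
    rewrite ler_wpM2l// (le_trans (pdist_xy _ _))// pdist2//.
  by rewrite pdistE subrr enorm0.
have hL : 0 <= L1 + L2 * cB by exact: addr_ge0 L10 (mulr_ge0 L20 cB0).
have hL1 : 0 <= 2 * L1 by exact: mulr_ge0.
apply: saga_dist => // j; (apply: le_trans (hessGz_lipschitz FB j _ _ x0) _);
  (apply: lerD; [apply: (ler_wpM2l hL); apply: pdist2|apply: (ler_wpM2l hL1); exact: bz]) => //.
by rewrite pdistE subrr enorm0.
Qed.

Let bias0 : enorm (lagrangian_grad f g (pxy p0) (pz p0) - col_mx (Gam x0) 0)
  <= cL * b + L1 * (2 * b + cB).
Proof.
rewrite -(lagrangian_grad_star B).
apply: le_trans (lagrangian_grad_lipschitz B _ _ _ _) _.
apply: lerD; apply: ler_wpM2l => //.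
  by rewrite /pxy col_mxB subrr enorm_col_0mx.
by apply: bz; rewrite pdistE subrr enorm0.
Qed.

(** The three summands bound the direction [v_(-1)], the hypergradient at [x_0], and
the distance from the latter of the first sampled direction. *)
Definition init_vel := b + (1 + 2 * b * (2 * Q + 1))
  + (2 * (Lf * (2 * b)) + 2 * DG + (cL * b + L1 * (2 * b + cB))).

Lemma enorm_init_vel eta l : 0 <= eta -> eta <= 1 ->
  enorm (momentum_step F G eta l.1 l.2 sm1 - Gam x0) <= init_vel.
Proof.
move=> eta0 eta1; rewrite /momentum_step dir_xE -surjective_pairing.
set v := usubmx _; have -> : (1 - eta) *: vx sm1 + eta *: v - Gam x0 =
    (1 - eta) *: (vx sm1 - Gam x0) + eta *: (v - Gam x0).
  move: v (Gam x0) (vx sm1) => v1 v2 v3.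
  by apply/colP => i; rewrite !mxE; ring.
have hv : enorm (v - Gam x0) <= 2 * (Lf * (2 * b)) + 2 * DG + (cL * b + L1 * (2 * b + cB)).
  have -> : v - Gam x0 = usubmx (dir_xz F G (memf sm1) (memg sm1) l (cur sm1)
      - col_mx (Gam x0) 0) by rewrite usubmxB col_mxKu.
  apply: le_trans (enorm_usubmx _) _.
  apply: le_trans (enorm_dist (lagrangian_grad f g (pxy p0) (pz p0)) _ _) _.
  by apply: lerD; [exact: dir_dist|exact: bias0].
have hG : enorm (Gam x0) <= 1 + 2 * b * (2 * Q + 1).
  have := hypergrad_gap gap; rewrite -/x0.
  have := sqr_ge0 (enorm (Gam x0) - 1).
  move: (enorm (Gam x0)) (enorm_ge0 (Gam x0)) (2 * b * _) => a a0 k; lra.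
have h1 := enormB (vx sm1) (Gam x0).
apply: le_trans (enormD _ _) _; rewrite !enormZ !ger0_norm//; last by lra.
rewrite /init_vel; apply: lerD.
  apply: le_trans (_ : enorm (vx sm1 - Gam x0) <= _); last by have := bv; lra.
  by rewrite ler_piMl//; lra.
by apply: le_trans hv; rewrite ler_piMl.
Qed.


Definition init_const := init_vel ^+ 2 + weight_y Lf Cf L1 L2 mu * b ^+ 2
  + weight_z Lf Cf L1 L2 mu * (2 * b + cB) ^+ 2 + weight_w Lf Cf L1 L2 mu * (2 * b ^+ 2).

Let mem_dist s (w : 'I_s -> triple R dx dy) l : (0 < s)%N ->
  (forall i, pdist (w i) p0 <= b) ->
  mem_error (remember w l (cur sm1)) p0 <= b ^+ 2.
Proof.
move=> s0 wb; apply: mean_le_cst => [|i]; first by rewrite card_ord.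
rewrite lerXn2r ?nnegrE ?pdist_ge0// pdistC /remember.
by case: ifP.
Qed.

Lemma lyapunov_init (N q eta : R) l : 0 <= eta -> eta <= 1 ->
  0 <= q ^+ 2 * N -> q ^+ 2 * N <= 1 ->
  lyapunov F G ystar Lf Cf L1 L2 mu N q (first_step F G p0 eta l.1 l.2 sm1)
  <= H (px p0) + init_const.
Proof.
move=> eta0 eta1 qN0 qN1.
have [c0 c1 _ _ _] := step_etaP Lf0 Cf0 L10 L20 mu0.
have e0 := step_ratio_gt0 L1 Lf0 Cf0 L20 mu0.
have e1 := step_ratio_le1 L1 Lf0 Cf0 L20 mu0.
have wy0 := weight_y_ge0 L1 Lf0 Cf0 L20 mu0.
have wz0 := weight_z_ge0 L1 Lf0 Cf0 L20 mu0.
have ww0 := weight_w_ge0 L1 Lf0 Cf0 L20 mu0.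
set s0 := first_step _ _ _ _ _ _ _.
have V : err_v F G ystar s0 <= init_vel ^+ 2.
  have h := enorm_init_vel l eta0 eta1.
  by rewrite lerXn2r ?nnegrE//; exact: le_trans (enorm_ge0 _) h.
have Y : err_y ystar s0 <= b ^+ 2 by rewrite lerXn2r ?nnegrE.
have Z : err_z F G ystar s0 <= (2 * b + cB) ^+ 2.
  have h : enorm (pz p0 - zs x0) <= 2 * b + cB by apply: bz; rewrite pdistE subrr enorm0.
  by rewrite lerXn2r ?nnegrE//; exact: le_trans (enorm_ge0 _) h.
have W : err_w s0 <= 2 * b ^+ 2.
  by rewrite mulrDl !mul1r; apply: lerD; apply: mem_dist.
rewrite /lyapunov lerD2l.
have c2 : weight_w Lf Cf L1 L2 mu * step_eta Lf Cf L1 L2 mu ^+ 2 * (q ^+ 2 * N) <=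
    weight_w Lf Cf L1 L2 mu.
  rewrite -mulrA ler_piMr// mulr_ile1 ?sqr_ge0//.
  by rewrite expr_le1// ltW.
have h : err_v F G ystar s0 + weight_y Lf Cf L1 L2 mu * err_y ystar s0
  + weight_z Lf Cf L1 L2 mu * err_z F G ystar s0
  + weight_w Lf Cf L1 L2 mu * step_eta Lf Cf L1 L2 mu ^+ 2 * (q ^+ 2 * N) * err_w s0
  <= init_const.
  apply: lerD; [apply: lerD; [apply: lerD => //|]|].
  - exact: ler_wpM2l.
  - exact: ler_wpM2l.
  apply: le_trans (ler_wpM2r (err_w_ge0 _) c2) _.
  exact: ler_wpM2l.
apply: le_trans (ler_wpM2l (ltW e0) h) _; rewrite ler_piMl//.
apply: le_trans h.
rewrite !addr_ge0//; first exact: sqr_ge0.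
- exact: mulr_ge0 (sqr_ge0 _).
- exact: mulr_ge0 (sqr_ge0 _).
exact: mulr_ge0 (mulr_ge0 (mulr_ge0 ww0 (sqr_ge0 _)) qN0) (err_w_ge0 _).
Qed.

End Initial.

(** * Telescoping along the iterates *)

Section Run.
Variables (R : realType) (dx dy n m : nat).
Variables (F : 'I_n -> 'cV[R]_(dx + dy) -> R) (G : 'I_m -> 'cV[R]_(dx + dy) -> R).
Variables (sm1 : saba_state R dx dy n m) (p0 : triple R dx dy) (alpha eta : R).
Let L : finType := ('I_n * 'I_m)%type.

Fixpoint run (k : nat) : history L k -> saba_state R dx dy n m :=
  match k with
  | 0 => fun l => first_step F G p0 eta l.1 l.2 sm1
  | k'.+1 => fun h => pair_step F G alpha eta (run h.1) h.2
  end.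

Lemma ma_saba_run (i : nat -> 'I_n) (j : nat -> 'I_m) k :
  ma_saba F G sm1 p0 (fun=> alpha) (fun=> eta) (fun=> eta) (fun=> eta) i j k =
  run (history_of (fun t => (i t, j t)) k).
Proof. by elim: k => [|k IH] //=; rewrite IH. Qed.

Lemma mean_run_telescope (V h : saba_state R dx dy n m -> R) (a lo up : R) :
  (0 < n)%N -> (0 < m)%N ->
  (forall s, mean (fun l => V (pair_step F G alpha eta s l)) <= V s - a * h s) ->
  (forall s, lo <= V s) ->
  (forall l, V (first_step F G p0 eta l.1 l.2 sm1) <= up) ->
  forall K, a * \sum_(k < K) mean (fun w : history L k => h (run w)) <= up - lo.
Proof.
move=> n0 m0 step Vlo Vup.
have L0 : (0 < #|L|)%N by rewrite card_pair_gt0 ?card_ord.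
have hist0 k : (0 < #|history L k|)%N by rewrite card_history expn_gt0 L0.
pose E k := mean (fun w : history L k => V (run w)).
have tele K : E K + a * \sum_(k < K) mean (fun w : history L k => h (run w)) <= up.
  elim: K => [|K IH]; first by rewrite big_ord0 mulr0 addr0; exact: mean_le_cst.
  rewrite big_ord_recr mulrDr /=; apply: le_trans IH; rewrite addrCA [leRHS]addrC lerD2l.
  have : E K.+1 <= E K - a * mean (fun w : history L K => h (run w)).
    rewrite /E mean_pair -meanZ -meanN -meanD.
    by apply: mean_le => w; exact: (step (run w)).
  lra.
move=> K; have := tele K; have : lo <= E K.
  by rewrite -[lo](mean_cst (hist0 K)); apply: mean_le.
lra.
Qed.

End Run.

Theorem theorem3p5 (R : realType) (Lf Cf L1g L2g mu : R)
    (hLf : 0 <= Lf) (hCf : 0 < Cf) (hL1g : 0 <= L1g) (hL2g : 0 <= L2g)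
    (hmu : 0 < mu) :
  exists c1 c2 c3 c4 : R, [/\ 0 < c1, 0 < c2, 0 < c3 & 0 < c4] /\
  (* B bounds the initial data, C is the constant hidden in the O *)
  forall B : R, exists C : R,
  forall (dx dy n m : nat) (hn : (0 < n)%N) (hm : (0 < m)%N)
    (F : 'I_n -> 'cV[R]_(dx + dy) -> R) (G : 'I_m -> 'cV[R]_(dx + dy) -> R)
    (ystar : 'cV[R]_dx -> 'cV[R]_dy),
  let f := avg F in
  let g := avg G in
  let H := upper_value f ystar in
  (forall i p, differentiable (F i) p) ->
  (forall j, twice_differentiable (G j)) ->
  (forall x, is_argmin (fun y => g (col_mx x y)) (ystar x)) ->
  (* (i) *)
  grad_lipschitz Lf f ->
  (forall x, enorm (grad2 f (col_mx x (ystar x))) <= Cf) ->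
  (* (ii) *)
  grad_lipschitz L1g g ->
  hess_lipschitz L2g g ->
  (forall x, strongly_convex mu (fun y => g (col_mx x y))) ->
  (* (iii) *)
  (forall i, grad_lipschitz Lf (F i)) ->
  (forall j, grad_lipschitz L1g (G j)) ->
  (forall j, hess_lipschitz L2g (G j)) ->
  forall (sm1 : saba_state R dx dy n m) (p0 : triple R dx dy),
  (forall x, H (px p0) - H x <= B) ->
  enorm (py p0 - ystar (px p0)) <= B ->
  enorm (pz p0) <= B ->
  enorm (vx sm1) <= B ->
  pdist (cur sm1) p0 <= B ->
  (forall i, pdist (memf sm1 i) p0 <= B) ->
  (forall j, pdist (memg sm1 j) p0 <= B) ->
  forall (d : measure_display) (T : measurableType d) (P : probability T R)
    (I : nat -> T -> 'I_n) (J : nat -> T -> 'I_m),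
  independent_uniform_indices P I J ->
  forall K : nat, (1 < K)%N ->
  let rate (c : R) (_ : nat) := c * (n + m)%:R `^ (- (2 / 3)) in
  let x k w := px (cur (ma_saba F G sm1 p0 (rate c1) (rate c2) (rate c3) (rate c4)
                          (fun t => I t w) (fun t => J t w) k)) in
  ((K%:R^-1)%:E * \sum_(k < K) 'E_P[fun w => (enorm (grad H (x k w)) ^+ 2)%R]
     <= (C * ((n + m)%:R `^ (2 / 3) * K%:R^-1))%:E)%E.
Proof.
pose c := step_eta Lf Cf L1g L2g mu; pose eps := step_ratio Lf Cf L1g L2g mu.
have [c0 c1 _ _ _] := step_etaP hLf hCf hL1g hL2g hmu; rewrite -/c in c0 c1.
have e0 : 0 < eps := step_ratio_gt0 L1g hLf hCf hL2g hmu.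
have ec0 : 0 < eps * c by rewrite mulr_gt0.
exists (eps * c), c, c, c; split; first by split.
move=> B; exists (2 * (B + init_const Lf Cf L1g L2g mu B) / (eps * c)).
move=> dx dy n m hn hm F G ystar f g H dF dG argm lf bf lg hg sc lF lG hG.
move=> sm1 p0 gap by0 bz0 bv bcur bmf bmg d T P I J IJ K K1 /=.
have FB : finite_sum_bilevel F G ystar Lf Cf L1g L2g mu.
  split=> //; split=> //.
    by move=> p; apply: differentiable_avg => i; exact: dF.
  exact: twice_differentiable_avg.
pose N : R := (n + m)%:R; pose q := N `^ (- (2 / 3)).
have N1 : 1 <= N by rewrite ler1n addn_gt0 hn.
have N0 : 0 < N by lra.
have q0 : 0 < q by rewrite powR_gt0.
have qN : q^-1 = N `^ (2 / 3) by rewrite /q powRN invrK.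
have q1 : q <= 1.
  by rewrite -invf_ge1// qN -[leLHS](powRr0 N) ler_powR// divr_ge0.
have Nq : N ^+ 2 * q ^+ 3 = 1.
  have -> : N ^+ 2 = (q^-1) ^+ 3.
    rewrite qN -!powR_mulrn ?powR_ge0 ?(ltW N0)// -powRrM; congr (_ `^ _).
    by field.
  by rewrite -exprMn mulVf ?expr1n// gt_eqF.
have q2N0 : 0 <= q ^+ 2 * N by rewrite mulr_ge0 ?sqr_ge0// ltW.
have q2N : q ^+ 2 * N <= 1.
  rewrite -(ler_pXn2r (n := 2))// ?nnegrE// expr1n.
  by rewrite [leLHS](_ : _ = N ^+ 2 * q ^+ 3 * q); [rewrite Nq mul1r|ring].
pose eta := c * q; pose alpha := eps * eta.
have eta0 : 0 < eta by rewrite mulr_gt0.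
have eta1 : eta <= 1 by rewrite mulr_ile1// ltW.
have al0 : 0 < alpha by rewrite mulr_gt0.
pose V := lyapunov F G ystar Lf Cf L1g L2g mu N q.
pose h (s : saba_state R dx dy n m) := enorm (grad H (px (cur s))) ^+ 2.
have nmN : n%:R + m%:R <= N by rewrite -natrD.
have dec s : mean (fun l => V (pair_step F G alpha eta s l)) <= V s - alpha / 2 * h s.
  exact: lyapunov_decrease.
have lo s : H (px p0) - B <= V s.
  apply: le_trans (_ : H (px (cur s)) <= _); first by have := gap (px (cur s)); lra.
  exact: (lyapunov_ge FB).
have up l : V (first_step F G p0 eta l.1 l.2 sm1) <=
    H (px p0) + init_const Lf Cf L1g L2g mu B.
  exact: (lyapunov_init FB gap by0 bz0 bv bcur bmf bmg l (ltW eta0) eta1 q2N0 q2N).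
have tele := mean_run_telescope hn hm dec lo up K.
rewrite -/N -/q -/eta (_ : eps * c * q = alpha); last by rewrite /alpha /eta mulrA.
under eq_bigr => k _.
  under eq_fun do rewrite ma_saba_run -/(h _).
  rewrite (expectation_history IJ (psi := fun v => h (run F G sm1 p0 alpha eta v))); last first.
    by move=> v; exact: sqr_ge0.
  over.
rewrite sumEFin -EFinM lee_fin.
have K0 : 0 < K%:R :> R by rewrite ltr0n (ltn_trans _ K1).
rewrite -/N -qN mulrA [leRHS]mulrC ler_wpM2l ?invr_ge0 ?(ltW K0)//.
rewrite (_ : _ / q = (2 * (B + init_const Lf Cf L1g L2g mu B)) / alpha); last first.
  by rewrite /alpha /eta; field; rewrite !gt_eqF.
rewrite ler_pdivlMr//; lra.
Qed.
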